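(* Let $\mathcal{C}$ be a proper cone in a finite-dimensional real vector space $V$. Then $\mathcal{C}$ is non-classical if and only if it admits a kite-square sandwiching.
   Context: All vector spaces are real and finite-dimensional. A (convex) cone in $V$ is a subset $\mathcal{C}\subset V$ with $sx+ty\in\mathcal{C}$ for all $x,y\in\mathcal{C}$ and $s,t\in[0,\infty)$. It is proper if it is closed, $\mathcal{C}\cap(-\mathcal{C})=\{0\}$ and $\mathcal{C}-\mathcal{C}=V$. It is classical if there is a vector space basis $A$ of $V$ such that $\mathcal{C}$ is the cone generated by $A$ (equivalently, $\mathcal{C}$ is linearly isomorphic to $\mathbb{R}_+^{\dim V}$); non-classical means not classical. For a convex set $K\subset\mathbb{R}^n$, the cone over $K$ is $\mathscr{C}(K)=\{(x;t)\in\mathbb{R}^n\times[0,\infty) : x\in tK\}\subset\mathbb{R}^n\times\mathbb{R}$, i.e. the cone generated by $K\times\{1\}$. The blunt square is $\mathsf{S}_b=[-1,1]^2\setminus\{-1,1\}^2$. For $\alpha=(\alpha_1,\alpha_2,\alpha_3,\alpha_4)\in(-1,1)^4$, the kite $\mathsf{Q}_\alpha$ is $$\mathsf{Q}_\alpha=\operatorname{conv}\{(1,\alpha_1),(\alpha_2,1),(-1,\alpha_3),(\alpha_4,-1)\}\subset\mathbb{R}^2.$$ A proper cone $\mathcal{C}\subset V$ admits a kite-square sandwiching if there exist $\alpha\in(-1,1)^4$ and linear maps $\Psi:\mathbb{R}^3\to V$, $\Phi:V\to\mathbb{R}^3$ such that $\Phi\circ\Psi=\mathrm{Id}$, $\Psi(\mathscr{C}(\mathsf{Q}_\alpha))\subset\mathcal{C}$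 and $\Phi(\mathcal{C})\subset\mathscr{C}(\mathsf{S}_b)$ (with $\mathbb{R}^3=\mathbb{R}^2\times\mathbb{R}$). *)

(* Defs.v *)
From HB Require Import structures.
From mathcomp Require Import all_boot all_order all_algebra.
From mathcomp Require Import all_classical all_reals all_analysis.

Set Implicit Arguments.
Unset Strict Implicit.
Unset Printing Implicit Defensive.
Import Order.TTheory GRing.Theory Num.Theory.
Import numFieldNormedType.Exports.
Local Open Scope classical_set_scope.
Local Open Scope ring_scope.

Section Cones.
Context {R : realType} {V : vectType R}.
Implicit Types (A C : set V).

Definition convex_cone C : Prop :=
  forall (x y : V) (s t : R), C x -> C y -> 0 <= s -> 0 <= t ->
    C (s *: x + t *: y).

(* A vectType carries no topology of its own: this is closedness for the usual
   topology of the coordinate space 'rV[R]_(dim V), transported along the linear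
   isomorphism r2v. As dim V is finite, it does not depend on the coordinates. *)
Definition vclosed C : Prop :=
  closed (VectorInternalTheory.r2v @^-1` C : set 'rV[R]_(dim V)).

Definition proper_cone C : Prop :=
  [/\ convex_cone C,
      vclosed C,
      C `&` [set - x | x in C] = [set 0] &
      [set x - y | x in C & y in C] = [set: V]].

(* The condition [D 0] only matters for A = set0: it makes the cone generated
   by the empty set (e.g. by the basis of the zero space) equal to {0}, although
   the empty set vacuously satisfies convex_cone. *)
Definition cone_gen A : set V := smallest (fun D => convex_cone D /\ D 0) A.

Definition classical C : Prop :=
  exists A : seq V, basis_of {:V} A /\ C = cone_gen [set` A].

End Cones.

Section Sandwiching.
Context {R : realType}.

Definition cone_over (n : nat) (K : set 'rV[R]_n) : set ('rV[R]_n * R^o) :=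
  [set p | 0 <= p.2 /\ [set p.2 *: x | x in K] p.1].

Definition conv_hull (n : nat) (A : set 'rV[R]_n) : set 'rV[R]_n :=
  smallest (@convex_set R 'rV[R]_n) A.

Definition pt (x y : R) : 'rV[R]_2 := \row_(i < 2) [:: x; y]`_i.

Definition blunt_square : set 'rV[R]_2 :=
  [set p | forall i, -1 <= p 0 i <= 1] `\`
  [set p | forall i, p 0 i = -1 \/ p 0 i = 1].

Definition kite (a1 a2 a3 a4 : R) : set 'rV[R]_2 :=
  conv_hull [set pt 1 a1; pt a2 1; pt (-1) a3; pt a4 (-1)].

Definition kite_square_sandwiching (V : vectType R) (C : set V) : Prop :=
  exists a1 a2 a3 a4 : R,
    [/\ -1 < a1 < 1, -1 < a2 < 1, -1 < a3 < 1 & -1 < a4 < 1] /\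
    exists (Psi : 'Hom(('rV[R]_2 * R^o)%type, V))
           (Phi : 'Hom(V, ('rV[R]_2 * R^o)%type)),
      [/\ (Phi \o Psi)%VF = \1%VF,
          Psi @` cone_over (kite a1 a2 a3 a4) `<=` C &
          Phi @` C `<=` cone_over blunt_square].

End Sandwiching.

(* Main.v *)
(* If C is generated by a basis, the crossing point of the diagonals of a kite
   has two decompositions in C whose supports coincide; each basis vector occurring
   in them is then sent by Phi to the ray over a corner of the square, hence to 0.

   Conversely, call z1, z3 in C a good pair if neither is interior but z1 + z3 is,
   and take one minimizing the sum of the dimensions of the faces F1, F3 which they
   generate. By a Straszewicz-Asplund perturbation both faces may be assumed exposed,
   by f1 and f3 say. Minimality forces F1 + F3 to be the whole section of C by its
   span N, and the sum to be direct. If N = V, then C is a direct sum of F1 and F3,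
   and one inducts on the dimension. Otherwise let u = f1 + f3 and choose k, vanishing
   on N, and r > 0 such that u + k and r u - k are nonnegative on C and vanish at
   points v4 and v2 of C with v2 + v4 in N. Writing v2 + v4 = v1 + v3 with v1 in F1
   and v3 in F3, the relations v1 + v3 = v2 + v4 and
   (1 + r) f1 + (1 + r) f3 = (r u - k) + (u + k) give the sandwiching. *)
Require Import Defs.
From HB Require Import structures.
From mathcomp Require Import all_boot all_order all_algebra.
From mathcomp Require Import all_classical all_reals all_analysis.
From mathcomp Require Import ring lra.
Set Implicit Arguments.
Unset Strict Implicit.
Unset Printing Implicit Defensive.
Import Order.TTheory GRing.Theory Num.Theory.
Import numFieldNormedType.Exports.
Local Open Scope classical_set_scope.
Local Open Scope ring_scope.

(** Exposedness is what gives the corners of the square their role: if f1 and f3 vanish on C exactly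
    along F1 and F3, then a point of C killed by f1 or f3 lies in N, where u + k and r u - k are u
    and r u. If one of these vanishes too, so does u, and the point goes to the apex of the cone
    over the square.

    The pair (k, r) comes from a duality. For y in C, let f range over the functionals nonnegative
    on C that equal u on N, and v over the points of C with y + v in N. Then (f - u) y = u v - f v
    is at most u v, and equality is attained, with f v = 0. Maximizing (f - u) y jointly in f and in
    y with u y = 1 gives r, k = f - u, v2 = y and v4 = v: maximality in y makes r u - k nonnegative
    on C and zero at y, while u + k = f is nonnegative and zero at v.

    Compactness of the sets involved comes from an interior point of C on the dual side and from the
    strict positivity of u on the primal side. *)

Section Toolkit.
Context {R : realType}.

(** * Compactness arguments for continuous real functions *)

Section ContinuousFunctions.
Context {T : topologicalType}.
Implicit Types (f g : T -> R) (X : set T).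

Lemma continuous_sum (I : Type) (r : seq I) (P : pred I) (F : I -> T -> R) :
  (forall i, continuous (F i)) ->
  continuous (fun x => \sum_(i <- r | P i) F i x).
Proof.
move=> cF; elim: r => [|i r IHr].
  by under eq_fun do rewrite big_nil; exact: cst_continuous.
under eq_fun do rewrite big_cons; case: (P i) => // x.
by apply: cvgD; [exact: cF | exact: IHr].
Qed.

Lemma continuous_addf f g :
  continuous f -> continuous g -> continuous (fun x => f x + g x).
Proof. by move=> cf cg x; apply: cvgD; [exact: cf | exact: cg]. Qed.

Lemma continuous_subf f g :
  continuous f -> continuous g -> continuous (fun x => f x - g x).
Proof. by move=> cf cg x; apply: cvgB; [exact: cf | exact: cg]. Qed.

Lemma continuous_mulf a f : continuous f -> continuous (fun x => a * f x).
Proof. by move=> cf x; apply: cvgM; [exact: cvg_cst | exact: cf]. Qed.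

Lemma closed_superlevel f a : continuous f -> closed [set x | a <= f x].
Proof.
move=> cf; apply: (@preimage_closed _ _ f [set y | a <= y]).
  by move=> x _; exact: cf.
exact: closed_ge.
Qed.

Lemma closed_sublevel f a : continuous f -> closed [set x | f x <= a].
Proof.
move=> cf; apply: (@preimage_closed _ _ f [set y | y <= a]).
  by move=> x _; exact: cf.
exact: closed_le.
Qed.

Lemma closed_level f a : continuous f -> closed [set x | f x = a].
Proof.
move=> cf.
have -> : [set x | f x = a] = [set x | a <= f x] `&` [set x | f x <= a].
  rewrite predeqE => x /=; split=> [->//|[h1 h2]].
  by apply/eqP; rewrite eq_le h1 h2.
by apply: closedI; [exact: closed_superlevel | exact: closed_sublevel].
Qed.

Lemma compact_argmax f X : X !=set0 -> compact X -> continuous f ->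
  exists2 x, X x & forall y, X y -> f y <= f x.
Proof.
move=> X0 cX cf.
have [x xX H] := compact_EVT_max X0 cX (continuous_subspaceT cf).
exists x; first by rewrite inE in xX.
by move=> y yX; apply: H; rewrite inE.
Qed.

Lemma compact_argmin f X : X !=set0 -> compact X -> continuous f ->
  exists2 x, X x & forall y, X y -> f x <= f y.
Proof.
move=> X0 cX cf.
have [x xX H] := compact_EVT_min X0 cX (continuous_subspaceT cf).
exists x; first by rewrite inE in xX.
by move=> y yX; apply: H; rewrite inE.
Qed.

(** On the compact part of X where g is nonpositive, f has a positive minimum, and g is bounded
    below on X: a large multiple of f outweighs g. *)
Lemma compact_penalty f g X : compact X -> continuous f -> continuous g ->
  (forall x, X x -> 0 <= f x) -> (forall x, X x -> f x = 0 -> 0 < g x) ->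
  exists2 t, 0 <= t & forall x, X x -> 0 < t * f x + g x.
Proof.
move=> cX cf cg f0 g0.
pose Y := X `&` [set x | g x <= 0].
have cY : compact Y by apply: compact_closedI => //; exact: closed_sublevel.
have [Y0|/set0P Yn0] := eqVneq Y set0.
  exists 0 => // x Xx; rewrite mul0r add0r ltNge; apply/negP => gx.
  by have : Y x by []; rewrite Y0.
have [y [Xy gy] ymin] := compact_argmin Yn0 cY cf.
have [x0 Xx0 x0min] := compact_argmin (ex_intro _ _ Xy) cX cg.
have fy : 0 < f y.
  rewrite lt_neqAle f0// andbT; apply/eqP => fy0.
  by have := g0 y Xy (esym fy0); rewrite ltNge gy.
have t0 : 0 <= (`|g x0| + 1) / f y by rewrite divr_ge0// ltW.
exists ((`|g x0| + 1) / f y) => // x Xx; have [gx|gx] := leP (g x) 0; last first.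
  by rewrite ltr_wpDl// mulr_ge0 ?f0.
have h2 : `|g x0| + 1 <= (`|g x0| + 1) / f y * f x.
  rewrite -{1}[leLHS](divfK (lt0r_neq0 fy)).
  by apply: ler_wpM2l => //; exact: ymin.
have h3 := x0min x Xx.
have h4 := ler_norm (- g x0); rewrite normrN in h4.
by lra.
Qed.

(** If every x violates some constraint, the same constraint fails by more than e for all points
    near x and all small e. By compactness a single e then works on all of X, against the
    approximate solution for that e. *)
Lemma compact_limit_ge0 (I : Type) (S : set I) (F : I -> T -> R) X :
  compact X -> (forall i, S i -> continuous (F i)) ->
  (forall e, 0 < e -> exists2 x, X x & forall i, S i -> - e <= F i x) ->
  exists2 x, X x & forall i, S i -> 0 <= F i x.
Proof.
move=> cX cF H; apply: contrapT => nH.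
have /compact_near_coveringP ncX := cX.
pose P (e : R) (x : T) := exists2 i, S i & F i x < - e.
have hcov x : X x -> \forall x' \near x & e \near 0^'+, P e x'.
  move=> Xx.
  have [i Si Fi] : exists2 i, S i & F i x < 0.
    apply: contrapT => nE; apply: nH; exists x => // i Si.
    by rewrite leNgt; apply/negP => Fi; apply: nE; exists i.
  near=> x' e; exists i => //.
  have h1 : F i x' < F i x / 2.
    near: x'; have := cF i Si x; move/cvgr_lt; apply.
    by lra.
  have h2 : e < - F i x / 2.
    near: e; apply: nbhs_right_lt; lra.
  by move=> /=; lra.
have hnear : \forall e \near 0^'+, X `<=` P e by exact: ncX.
have [e [e0 he]] : exists e : R, 0 < e /\ X `<=` P e.
  have : \forall e \near 0^'+, 0 < e /\ X `<=` P e.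
    by apply: filterI hnear; exact: nbhs_right_gt.
  exact: filter_ex.
have [x Xx Fx] := H e e0.
have [i Si] := he x Xx; rewrite ltNge => /negP; apply; exact: Fx.
Unshelve. all: by end_near. Qed.

End ContinuousFunctions.
End Toolkit.

(** * The scalar product and continuity in coordinates *)

Section Dot.
Context {R : realType}.

Definition dot n (x y : 'rV[R]_n) : R := \sum_i x 0 i * y 0 i.

Section DotTheory.
Context {n : nat}.
Implicit Types x y z : 'rV[R]_n.

Lemma dotC x y : dot x y = dot y x.
Proof. by apply: eq_bigr => i _; rewrite mulrC. Qed.

Lemma dotDl x y z : dot (x + y) z = dot x z + dot y z.
Proof. by rewrite -big_split; apply: eq_bigr => i _; rewrite mxE mulrDl. Qed.

Lemma dotDr x y z : dot z (x + y) = dot z x + dot z y.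
Proof. by rewrite dotC dotDl !(dotC z). Qed.

Lemma dotZl a x y : dot (a *: x) y = a * dot x y.
Proof. by rewrite mulr_sumr; apply: eq_bigr => i _; rewrite mxE mulrA. Qed.

Lemma dotZr a x y : dot x (a *: y) = a * dot x y.
Proof. by rewrite dotC dotZl dotC. Qed.

Lemma dotNl x y : dot (- x) y = - dot x y.
Proof. by rewrite -scaleN1r dotZl mulN1r. Qed.

Lemma dotNr x y : dot x (- y) = - dot x y.
Proof. by rewrite dotC dotNl dotC. Qed.

Lemma dotBl x y z : dot (x - y) z = dot x z - dot y z.
Proof. by rewrite dotDl dotNl. Qed.

Lemma dotBr x y z : dot z (x - y) = dot z x - dot z y.
Proof. by rewrite dotDr dotNr. Qed.

Lemma dot0l x : dot 0 x = 0.
Proof. by rewrite -(scale0r 0) dotZl mul0r. Qed.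

Lemma dot0r x : dot x 0 = 0.
Proof. by rewrite dotC dot0l. Qed.

Definition dotE := (dotDl, dotDr, dotZl, dotZr, dotNl, dotNr, dot0l, dot0r).

Lemma dot_ge0 x : 0 <= dot x x.
Proof. by apply: sumr_ge0 => i _; rewrite -expr2 sqr_ge0. Qed.

Lemma sqr_coord_le_dot x i : x 0 i ^+ 2 <= dot x x.
Proof.
rewrite /dot (bigD1 i)//= -expr2 lerDl.
by apply: sumr_ge0 => j _; rewrite -expr2 sqr_ge0.
Qed.

Lemma dot_eq0 x : dot x x = 0 -> x = 0.
Proof.
move=> x0; apply/rowP => i; rewrite mxE; apply/eqP.
by rewrite -sqrf_eq0 eq_le sqr_ge0 andbT -[leRHS]x0 sqr_coord_le_dot.
Qed.

Lemma dot_gt0 x : x != 0 -> 0 < dot x x.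
Proof.
move=> x0; rewrite lt_neqAle dot_ge0 andbT eq_sym.
by apply: contra x0 => /eqP /dot_eq0 ->.
Qed.

Lemma dot_delta x i : dot x (delta_mx 0 i) = x 0 i.
Proof.
rewrite /dot (bigD1 i)//= big1 ?addr0; first by rewrite mxE !eqxx mulr1.
by move=> j ji; rewrite mxE (negbTE ji) mulr0.
Qed.

Lemma coord_le_norm x i : `|x 0 i| <= `|x|.
Proof.
rewrite [leRHS]/Num.norm/= mx_normrE.
exact: (le_bigmax _ (fun ij : 'I_1 * 'I_n => `|x ij.1 ij.2|) (0, i)).
Qed.

Lemma norm_le_coord x r : 0 <= r -> (forall i, `|x 0 i| <= r) -> `|x| <= r.
Proof.
move=> r0 H; rewrite [leLHS]/Num.norm/= mx_normrE.
by apply: bigmax_le => // -[i j] _; rewrite (ord1 i).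
Qed.

(** The norm of row vectors is the maximum norm, whence the factor n. *)
Lemma dot_abs_le x y : `|dot x y| <= n%:R * (`|x| * `|y|).
Proof.
apply: (le_trans (ler_norm_sum _ _ _)).
rewrite mulr_natl -[X in _ *+ X]card_ord -sumr_const.
apply: ler_sum => i _; rewrite normrM.
by apply: ler_pM => //; exact: coord_le_norm.
Qed.

Lemma compact_bounded_in (A : set 'rV[R]_n) r :
  closed A -> (forall x, A x -> `|x| <= r) -> compact A.
Proof.
move=> cA Ar; apply: bounded_closed_compact => //.
exists r; split; first exact: num_real.
by move=> M rM x Ax; apply: (le_trans (Ar x Ax)); exact: ltW.
Qed.

Lemma dot_mulmxr m (x : 'rV[R]_n) (A : 'M[R]_(n, m)) (w : 'rV_m) :
  dot (x *m A) w = dot x (w *m A^T).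
Proof.
rewrite /dot; under eq_bigr do rewrite mxE mulr_suml.
rewrite exchange_big; apply: eq_bigr => i _ /=.
rewrite mxE mulr_sumr; apply: eq_bigr => j _.
by rewrite mxE mulrAC mulrA.
Qed.

End DotTheory.

Section CoordinateContinuity.
Context {T : topologicalType}.

Definition coord_cont n (f : T -> 'rV[R]_n) :=
  forall j, continuous (fun x => f x 0 j).

Lemma coord_cont_dot n (f g : T -> 'rV[R]_n) :
  coord_cont f -> coord_cont g -> continuous (fun x => dot (f x) (g x)).
Proof.
move=> cf cg; apply: continuous_sum => i x.
by apply: continuousM; [exact: cf | exact: cg].
Qed.

Lemma coord_cont_cst n (a : 'rV[R]_n) : coord_cont (fun _ => a).
Proof. by move=> j; exact: cst_continuous. Qed.

Lemma coord_contD n (f g : T -> 'rV[R]_n) :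
  coord_cont f -> coord_cont g -> coord_cont (fun x => f x + g x).
Proof.
move=> cf cg j; under eq_fun do rewrite mxE.
by move=> x; apply: cvgD; [exact: cf | exact: cg].
Qed.

Lemma coord_contB n (f g : T -> 'rV[R]_n) :
  coord_cont f -> coord_cont g -> coord_cont (fun x => f x - g x).
Proof.
move=> cf cg j; under eq_fun do rewrite !mxE.
by move=> x; apply: cvgB; [exact: cf | exact: cg].
Qed.

Lemma coord_cont_mulmx n m (f : T -> 'rV[R]_n) (A : 'M[R]_(n, m)) :
  coord_cont f -> coord_cont (fun x => f x *m A).
Proof.
move=> cf j; under eq_fun do rewrite mxE.
apply: continuous_sum => i x.
by apply: continuousM; [exact: cf | exact: cst_continuous].
Qed.

Lemma coord_cont_continuous n (f : T -> 'rV[R]_n) :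
  coord_cont f -> continuous f.
Proof.
move=> cf x; apply/cvg_ballP => e e0.
have H : \forall y \near x, forall j : 'I_n, ball (f x 0 j) e (f y 0 j).
  apply: filter_forall => j.
  by have /cvg_ballP := cf j x; apply.
near=> y; split => // i j; rewrite (ord1 i).
by move: j; near: y.
Unshelve. all: by end_near. Qed.

End CoordinateContinuity.

Lemma coord_cont_id n : coord_cont (fun x : 'rV[R]_n => x).
Proof. by move=> j; exact: coord_continuous. Qed.

Lemma coord_cont_fst n m : coord_cont (fun p : 'rV[R]_n * 'rV[R]_m => p.1).
Proof.
move=> j p; apply: (@continuous_comp _ _ _ fst (fun v : 'rV[R]_n => v 0 j)).
  exact: cvg_fst.
exact: coord_continuous.
Qed.

Lemma coord_cont_snd n m : coord_cont (fun p : 'rV[R]_n * 'rV[R]_m => p.2).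
Proof.
move=> j p; apply: (@continuous_comp _ _ _ snd (fun v : 'rV[R]_m => v 0 j)).
  exact: cvg_snd.
exact: coord_continuous.
Qed.

Lemma continuous_norm_sub n (z : 'rV[R]_n) :
  continuous (fun y : 'rV[R]_n => `|y - z|).
Proof.
have cf : continuous (fun y : 'rV[R]_n => y - z).
  by apply: coord_cont_continuous; apply: coord_contB;
     [exact: coord_cont_id | exact: coord_cont_cst].
by move=> x; exact: (cvg_norm (cf x)).
Qed.

Lemma compact_setI_ball n (S : set 'rV[R]_n) z r :
  closed S -> compact [set x | S x /\ `|x - z| <= r].
Proof.
move=> cS; apply: (@compact_bounded_in _ _ (r + `|z|)); last first.
  move=> x [_ xr]; rewrite -(subrK z x).
  by apply: (le_trans (ler_normD _ _)); rewrite lerD2r.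
have -> : [set x | S x /\ `|x - z| <= r] = S `&` [set x | `|x - z| <= r] by [].
apply: closedI => //; apply: closed_sublevel; exact: continuous_norm_sub.
Qed.

End Dot.

(** * Separation *)

Section Separation.
Context {R : realType} {n : nat}.
Implicit Types (S : set 'rV[R]_n) (x y : 'rV[R]_n).

Definition convex_subset S :=
  forall a b t, S a -> S b -> 0 <= t <= 1 -> S (a + t *: (b - a)).

Lemma nearest_point S x : closed S -> S !=set0 ->
  exists2 p, S p & forall s, S s -> dot (p - x) (p - x) <= dot (s - x) (s - x).
Proof.
move=> cS [s0 Ss0]; pose f y := dot (y - x) (y - x).
have cf : continuous f.
  by apply: coord_cont_dot; apply: coord_contB;
     [exact: coord_cont_id | exact: coord_cont_cst
     |exact: coord_cont_id | exact: coord_cont_cst].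
(* S may be unbounded; a nearest point is sought among those no farther than [s0]. Their coordinates
   relative to x have squares at most [f s0], hence are bounded by [1 + f s0]. *)
pose X := S `&` [set y | f y <= f s0].
have cX : compact X.
  apply: (@subclosed_compact _ _ [set y | S y /\ `|y - x| <= 1 + f s0]).
  - by apply: closedI => //; exact: closed_sublevel.
  - exact: compact_setI_ball.
  - move=> y [Sy fy]; split => //; have f0 : 0 <= f s0 by exact: dot_ge0.
    apply: norm_le_coord => [|i]; first by lra.
    have h := le_trans (sqr_coord_le_dot (y - x) i) fy.
    by rewrite ler_norml; apply/andP; split; nra.
have [p [Sp _] pmin] := compact_argmin (ex_intro _ s0 (conj Ss0 (lexx _))) cX cf.
exists p => // s Ss; have [h|/ltW h] := leP (f s) (f s0); first exact: pmin.
by apply: le_trans h; apply: pmin; split => /=.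
Qed.

(** Take for p the point of S nearest to x: moving from p towards any s in S cannot decrease the
    distance to x, so the derivative at p is nonnegative. *)
Lemma convex_separation S x :
  closed S -> convex_subset S -> S !=set0 -> ~ S x ->
  exists p, [/\ S p, p != x &
    forall s, S s -> dot (p - x) (p - x) <= dot (p - x) (s - x)].
Proof.
move=> cS vS S0 Sx; have [p Sp pmin] := nearest_point x cS S0.
exists p; split => //; first by apply/eqP => px; apply: Sx; rewrite -px.
move=> s Ss; rewrite -subr_ge0 -dotBr.
have -> : s - x - (p - x) = s - p by rewrite opprB addrA subrK.
have key t : 0 <= t <= 1 ->
    0 <= t * (2 * dot (p - x) (s - p) + t * dot (s - p) (s - p)).
  move=> t01; have := pmin _ (vS p s t Sp Ss t01).
  have -> : p + t *: (s - p) - x = (p - x) + t *: (s - p) by rewrite addrAC.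
  move: (p - x) (s - p) => a b; rewrite !dotE (dotC b a) => h.
  rewrite -subr_ge0 in h; apply: le_trans h _.
  by rewrite le_eqVlt; apply/orP; left; apply/eqP; ring.
rewrite leNgt; apply/negP => lt0.
set a := dot (p - x) (s - p) in key lt0; set b := dot _ _ in key.
have b0 : 0 <= b by exact: dot_ge0.
(* If a < 0, this t lies in (0, 1] and satisfies t b < - a, so 2 a + t b < 0, against [key]. *)
pose t := - a / (1 + b - a).
have d0 : 0 < 1 + b - a by lra.
have t0 : 0 < t by rewrite divr_gt0//; lra.
have t1 : t <= 1 by rewrite ler_pdivrMr//; lra.
have tE : t * (1 + b - a) = - a by rewrite mulfVK// lt0r_neq0.
have := key t; rewrite (ltW t0) t1 => /(_ isT); rewrite pmulr_rge0//.
by nra.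
Qed.

End Separation.

(** * Dual cones, order units and supporting hyperplanes *)

Section Cones.
Context {R : realType} {n : nat}.
Implicit Types (C : set 'rV[R]_n) (x y z g v : 'rV[R]_n).

Definition dual_cone C : set 'rV[R]_n := [set g | forall c, C c -> 0 <= dot g c].

(* In finite dimension, the order units of a convex cone are its interior points. *)
Definition order_unit C z := forall v, exists2 e, 0 < e & C (z + e *: v).

Variable C : set 'rV[R]_n.
Hypotheses (convC : convex_cone C) (C0 : C 0).

Lemma coneD x y : C x -> C y -> C (x + y).
Proof.
by move=> Cx Cy; have := convC Cx Cy ler01 ler01; rewrite !scale1r.
Qed.

Lemma coneZ a x : 0 <= a -> C x -> C (a *: x).
Proof.
by move=> a0 Cx; have := convC Cx C0 a0 (lexx 0); rewrite scaler0 addr0.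
Qed.

Lemma cone_sum (I : Type) (r : seq I) (F : I -> 'rV[R]_n) :
  (forall i, C (F i)) -> C (\sum_(i <- r) F i).
Proof. by move=> CF; elim/big_ind : _ => // x y; exact: coneD. Qed.

Lemma cone_convex : convex_subset C.
Proof.
move=> a b t Ca Cb /andP[t0 t1].
have -> : a + t *: (b - a) = (1 - t) *: a + t *: b.
  by rewrite scalerBr scalerBl scale1r addrA addrAC.
by apply: convC; rewrite ?subr_ge0.
Qed.

Lemma cone_direction_le x v e e' : C x -> C (x + e *: v) -> 0 <= e' <= e ->
  C (x + e' *: v).
Proof.
move=> Cx Ce /andP[e'0 e'e].
have [e0|e0] := leP e 0.
  have -> : e' = 0 by apply/eqP; rewrite eq_le e'0 (le_trans e'e).
  by rewrite scale0r addr0.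
have := cone_convex Cx Ce (t := e' / e).
rewrite addrAC subrr add0r scalerA divfK ?lt0r_neq0//; apply.
by rewrite divr_ge0 ?(ltW e0)//= ler_pdivrMr// mul1r.
Qed.

Lemma order_unit_mem z : order_unit C z -> C z.
Proof. by move=> /(_ 0) [e _]; rewrite scaler0 addr0. Qed.

Lemma order_unitD z c : order_unit C z -> C c -> order_unit C (z + c).
Proof.
move=> uz Cc v; have [e e0 h] := uz v; exists e => //.
by rewrite addrAC; exact: coneD.
Qed.

Lemma order_unitZ z a : 0 < a -> order_unit C z -> order_unit C (a *: z).
Proof.
move=> a0 uz v; have [e e0 h] := uz v; exists (a * e); first exact: mulr_gt0.
by rewrite -scalerA -scalerDr; apply: coneZ => //; exact: ltW.
Qed.

(** One e serves for all the signed basis vectors, and z + v is the mean of z and of the n points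
    obtained from z by moving n + 1 times the i-th coordinate of v along the i-th axis. *)
Lemma order_unit_ball z : order_unit C z ->
  exists2 r, 0 < r & forall v, `|v| <= r -> C (z + v).
Proof.
move=> uz; have Cz := order_unit_mem uz.
have [e [e0 he]] : exists e : R, 0 < e /\ forall i : 'I_n,
    C (z + e *: delta_mx 0 i) /\ C (z + e *: (- delta_mx 0 i)).
  have H : \forall e \near (0 : R)^'+, forall i : 'I_n,
      C (z + e *: delta_mx 0 i) /\ C (z + e *: (- delta_mx 0 i)).
    apply: filter_forall => i.
    have [e1 e10 h1] := uz (delta_mx 0 i).
    have [e2 e20 h2] := uz (- delta_mx 0 i).
    near=> e; have e0 : 0 <= e by near: e; exact: nbhs_right_ge.
    split; [apply: cone_direction_le h1 _ | apply: cone_direction_le h2 _] => //.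
      by rewrite e0/=; near: e; exact: nbhs_right_le.
    by rewrite e0/=; near: e; exact: nbhs_right_le.
  near (0 : R)^'+ => e; exists e; split; first by near: e; exact: nbhs_right_gt.
  by near: e.
exists (e / n.+1%:R); first by rewrite divr_gt0.
move=> v ve.
have Cv i : C (z + (n.+1%:R * v 0 i) *: delta_mx 0 i).
  have hv : `|n.+1%:R * v 0 i| <= e.
    rewrite normrM normr_nat -ler_pdivlMl// mulrC.
    exact: le_trans (coord_le_norm v i) ve.
  have [p0|p0] := leP 0 (n.+1%:R * v 0 i).
    apply: (cone_direction_le Cz (he i).1).
    by rewrite p0/=; apply: le_trans hv; exact: ler_norm.
  rewrite -[_ * _]opprK scaleNr -scalerN.
  apply: (cone_direction_le Cz (he i).2).
  by rewrite -(ltr0_norm p0) hv normr_ge0.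
have -> : z + v = n.+1%:R^-1 *:
    (z + \sum_i (z + (n.+1%:R * v 0 i) *: delta_mx 0 i)).
  rewrite big_split/= sumr_const card_ord addrA -mulrS scalerDr.
  rewrite -[z *+ _]scaler_nat scalerA mulVf// scale1r; congr (_ + _).
  rewrite {1}(row_sum_delta v) scaler_sumr; apply: eq_bigr => i _.
  by rewrite scalerA mulKf.
apply: coneZ; first by rewrite invr_ge0.
by apply: coneD => //; exact: cone_sum.
Unshelve. all: by end_near. Qed.

Lemma dual_order_unit_eq0 z g :
  order_unit C z -> dual_cone C g -> dot g z = 0 -> g = 0.
Proof.
move=> uz Dg gz; apply: dot_eq0; apply/eqP; rewrite eq_le dot_ge0 andbT.
have [e e0 h] := uz (- g).
by have := Dg _ h; rewrite !dotE gz add0r mulrN oppr_ge0 pmulr_rle0.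
Qed.

Lemma dual_order_unit_gt0 z g :
  order_unit C z -> dual_cone C g -> g != 0 -> 0 < dot g z.
Proof.
move=> uz Dg g0; rewrite lt_neqAle Dg ?andbT; last exact: order_unit_mem.
by rewrite eq_sym; apply: contra g0 => /eqP/(dual_order_unit_eq0 uz Dg) ->.
Qed.

Lemma dual_cone_comb g h a b : 0 <= a -> 0 <= b ->
  dual_cone C g -> dual_cone C h -> dual_cone C (a *: g + b *: h).
Proof.
move=> a0 b0 Dg Dh c Cc; rewrite !dotE.
by apply: addr_ge0; apply: mulr_ge0 => //; [exact: Dg | exact: Dh].
Qed.

Lemma closed_dual_cone : closed (dual_cone C).
Proof.
have -> : dual_cone C = \bigcap_(c in C) [set g | 0 <= dot g c] by [].
apply: closed_bigI => c Cc; apply: closed_superlevel.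
by apply: coord_cont_dot; [exact: coord_cont_id | exact: coord_cont_cst].
Qed.

(** C contains e + r v for all v of norm at most 1, which bounds - g v by g e / r. This is what
    makes the slices of the dual cone at e compact. *)
Lemma dual_cone_norm_le e : order_unit C e ->
  exists2 K, 0 <= K & forall g, dual_cone C g -> `|g| <= K * dot g e.
Proof.
move=> ue; have [r r0 hr] := order_unit_ball ue.
have Ce := order_unit_mem ue.
exists r^-1 => [|g Dg]; first by rewrite invr_ge0 ltW.
have nd (i : 'I_n) : `|delta_mx 0 i : 'rV[R]_n| <= 1.
  apply: norm_le_coord => // j; rewrite mxE eqxx/=.
  by case: (j == i); rewrite ?normr1 ?normr0.
have bound v : `|v| <= 1 -> - dot g v <= r^-1 * dot g e.
  move=> v1; have : C (e + r *: v).
    by apply: hr; rewrite normrZ gtr0_norm// -[leRHS]mulr1 ler_pM2l.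
  by move/Dg => h; rewrite [leRHS]mulrC ler_pdivlMr//; move: h; rewrite !dotE; lra.
apply: norm_le_coord => [|i]; first by rewrite mulr_ge0 ?invr_ge0 ?(ltW r0) ?Dg.
have := bound _ (nd i); have := bound (- delta_mx 0 i).
rewrite normrN dotNr dot_delta => /(_ (nd i)) h1 h2.
by rewrite ler_norml; apply/andP; split; lra.
Qed.

Lemma compact_dual_slice e a : order_unit C e ->
  compact (dual_cone C `&` [set g | dot g e = a]).
Proof.
move=> ue; have [K K0 hK] := dual_cone_norm_le ue.
apply: (@compact_bounded_in _ _ _ (K * a)) => [|g [Dg /= <-]]; last exact: hK.
apply: closedI; first exact: closed_dual_cone.
apply: closed_level.
by apply: coord_cont_dot; [exact: coord_cont_id | exact: coord_cont_cst].
Qed.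

Hypothesis closedC : closed C.

Lemma bipolar x : ~ C x -> exists2 g, dual_cone C g & dot g x < 0.
Proof.
move=> Cx.
have [p [Cp px sep]] := convex_separation closedC cone_convex (ex_intro _ 0 C0) Cx.
have d0 : 0 < dot (p - x) (p - x) by rewrite dot_gt0// subr_eq0.
have gx : dot (p - x) x < 0.
  by have := sep 0 C0; rewrite sub0r dotNr; lra.
exists (p - x) => // c Cc; rewrite leNgt; apply/negP => lt0.
(* If g = p - x were negative at c, the multiple of c at which g equals g x would contradict the
   strict separation of x from C. *)
have t0 : 0 <= dot (p - x) x / dot (p - x) c.
  by rewrite ler_ndivlMr// mul0r ltW.
have := sep _ (coneZ t0 Cc); rewrite [X in _ <= X]dotBr dotZr divfK ?lt_eqF//.
by lra.
Qed.

(** A subspace missing the interior lies in a supporting hyperplane. The restrictions to the rows of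
    M of the g in the dual cone with g e = 1 form a compact convex set. If it misses 0, its point p
    nearest to 0 satisfies g (p M) >= |p|^2 g e (Euclidean norm) for all these g; by [bipolar], p M
    - |p|^2 e is in C, and p M is an order unit. *)
Lemma support_subspace m (M : 'M[R]_(m, n)) e : order_unit C e ->
  (forall w, ~ order_unit C (w *m M)) ->
  exists g, [/\ dual_cone C g, g != 0 & forall w, dot g (w *m M) = 0].
Proof.
move=> ue noM; have Ce := order_unit_mem ue.
pose B := dual_cone C `&` [set g | dot g e = 1].
have [B0|/set0P Bn0] := eqVneq B set0.
  (* With no g in the base, the dual cone is {0} and C is the whole space by [bipolar], so 0 is an
     order unit. *)
  exfalso; apply: (noM 0) => v; exists 1; first exact: ltr01.
  apply: contrapT => /bipolar[g Dg gv].
  have g0 : g != 0 by apply/eqP => g0; move: gv; rewrite g0 dot0l ltxx.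
  have ge := dual_order_unit_gt0 ue Dg g0.
  have : B ((dot g e)^-1 *: g).
    split; last by rewrite /= dotZl mulVf// lt0r_neq0.
    by move=> c Cc; rewrite dotZl mulr_ge0 ?Dg// invr_ge0 ltW.
  by rewrite B0.
have cB : compact B by exact: compact_dual_slice.
have [[g [Dg ge] gM]|nB] := pselect (exists2 g, B g & g *m M^T = 0).
  exists g; split=> // [|w].
    by apply/eqP => g0; move: ge; rewrite g0 /= dot0l => /esym/eqP; rewrite oner_eq0.
  by rewrite dotC dot_mulmxr gM dot0r.
exfalso.
pose f (g : 'rV[R]_n) := g *m M^T.
have cf : continuous f.
  by apply: coord_cont_continuous; apply: coord_cont_mulmx; exact: coord_cont_id.
have cfB : closed (f @` B).
  apply: compact_closed; first exact: norm_hausdorff.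
  by apply: continuous_compact => //; exact: continuous_subspaceT.
have vfB : convex_subset (f @` B).
  move=> _ _ t [g [Dg ge] <-] [h [Dh he] <-] /andP[t0 t1].
  exists (g + t *: (h - g)); last by rewrite /f mulmxDl -scalemxAl mulmxBl.
  split; last by move: ge he => /=; rewrite !dotE => -> ->; ring.
  have -> : g + t *: (h - g) = (1 - t) *: g + t *: h.
    by rewrite scalerBr scalerBl scale1r addrA addrAC.
  by apply: dual_cone_comb => //; rewrite subr_ge0.
have nfB0 : ~ (f @` B) 0 by move=> [g Bg fg]; apply: nB; exists g.
have fBn0 : f @` B !=set0 by case: Bn0 => g Bg; exists (f g); exists g.
have [p [_ p0 sep]] := convex_separation cfB vfB fBn0 nfB0.
rewrite subr0 in sep; have pp := dot_gt0 p0.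
pose m0 := p *m M; pose c := dot p p.
have : C (m0 - c *: e).
  apply: contrapT => /bipolar[g Dg gm].
  have g0 : g != 0 by apply/eqP => g0; move: gm; rewrite g0 dot0l ltxx.
  have ge := dual_order_unit_gt0 ue Dg g0.
  have Bg : B ((dot g e)^-1 *: g).
    split; last by rewrite /= dotZl mulVf// lt0r_neq0.
    by move=> x Cx; rewrite dotZl mulr_ge0 ?Dg// invr_ge0 ltW.
  have := sep _ (ex_intro2 _ _ _ Bg erefl).
  rewrite subr0 /f -scalemxAl dotZr -dot_mulmxr -/m0 -/c dotC => h.
  rewrite mulrC (dotC e) (dotC m0) ler_pdivlMr// in h; move: gm; rewrite !dotE; lra.
move=> h; apply: (noM p); rewrite -/m0 -(subrK (c *: e) m0) addrC.
by apply: order_unitD => //; exact: order_unitZ.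
Qed.

End Cones.

(** * Subspaces, and strictly positive functionals on pointed convex sets *)

Section Slices.
Context {R : realType} {n : nat}.
Implicit Types (S L : set 'rV[R]_n).

(** Take a matrix of maximal rank among those whose row space is contained in L: a vector of L
    outside this row space would increase the rank. *)
Lemma subspace_matrix L : L 0 -> (forall a u v, L u -> L v -> L (a *: u + v)) ->
  exists B : 'M[R]_n, forall v, L v <-> (v <= B)%MS.
Proof.
move=> L0 linL.
pose P r := `[< exists B : 'M[R]_n,
  (forall v : 'rV_n, (v <= B)%MS -> L v) /\ \rank B = r >].
have P0 : exists r, P r.
  exists 0%N; apply/asboolP; exists 0; split; last exact: mxrank0.
  by move=> v; rewrite submx0 => /eqP ->.
have Pn r : P r -> (r <= n)%N by move=> /asboolP[B [_ <-]]; exact: rank_leq_col.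
have [r /asboolP[B [BL Br]] rmax] := ex_maxnP P0 Pn.
exists B => v; split; last exact: BL.
move=> Lv; apply: contrapT => /negP vB.
have /rmax : P (\rank (B + v)%MS).
  apply/asboolP; exists (B + v)%MS; split => // w /sub_addsmxP[[u a] /= ->].
  rewrite addrC (mx11_scalar a) mul_scalar_mx; apply: linL => //.
  by apply: BL; exact: submxMl.
rewrite -Br leqNgt => /negP; apply; apply: rank_ltmx.
by rewrite ltmxE addsmxSl; apply: contra vB; apply: submx_trans; exact: addsmxSr.
Qed.

Lemma closed_rowspace m (A : 'M[R]_(m, n)) : closed [set x : 'rV[R]_n | (x <= A)%MS].
Proof.
have -> : [set x : 'rV[R]_n | (x <= A)%MS] =
    [set x : 'rV[R]_n | dot (x *m cokermx A) (x *m cokermx A) = 0].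
  rewrite predeqE => x /=; rewrite submxE; split=> [/eqP->|/dot_eq0->//].
  exact: dot0l.
by apply: closed_level; apply: coord_cont_dot; apply: coord_cont_mulmx;
  exact: coord_cont_id.
Qed.

Lemma closed_sphere S r : closed S -> closed (S `&` [set x | `|x| = r]).
Proof.
by move=> cS; apply: closedI => //; apply: closed_level; exact: norm_continuous.
Qed.

Lemma compact_sphere S r : closed S -> compact (S `&` [set x | `|x| = r]).
Proof.
move=> cS; apply: (@compact_bounded_in _ _ _ r); first exact: closed_sphere.
by move=> x [_ /= ->].
Qed.

(** The points - t a0 with t small lie outside S and tend to 0; unit directions separating them from
    S accumulate at a functional nonnegative on S. It is kept in the span A so that it cannot vanish
    on A, which is what lets [extreme_slice] lower the rank. *)
Lemma support_at_extreme (A : 'M[R]_n) S a0 :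
  closed S -> convex_subset S -> S 0 ->
  (forall s, S s -> (s <= A)%MS) -> (forall s, S s -> S (- s) -> s = 0) ->
  S a0 -> a0 != 0 ->
  exists th, [/\ (th <= A)%MS, th != 0 & forall s, S s -> 0 <= dot th s].
Proof.
move=> cS vS S0 SA extS Sa0 a00.
have nS t : 0 < t <= 1 -> ~ S (- (t *: a0)).
  move=> /andP[t0 t1] h; have h' : S (t *: a0).
    by have := vS _ _ t S0 Sa0; rewrite (ltW t0) t1 subr0 add0r; apply.
  have /eqP := extS _ h' h.
  by rewrite scaler_eq0 (negbTE a00) orbF gt_eqF.
have cX : compact ([set x : 'rV[R]_n | (x <= A)%MS] `&` [set x | `|x| = 1]).
  by apply: compact_sphere; exact: closed_rowspace.
have cF s : S s -> continuous (fun th : 'rV[R]_n => dot th s).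
  by move=> _; apply: coord_cont_dot; [exact: coord_cont_id|exact: coord_cont_cst].
have [|th [thA th1] thS] := compact_limit_ge0 cX cF; last first.
  exists th; split=> //; apply/eqP => th0.
  by move: th1; rewrite /= th0 normr0 => /esym/eqP; rewrite oner_eq0.
move=> e e0; pose K : R := n%:R * `|a0| + 1.
have K0 : 0 < K by rewrite ltr_wpDl// mulr_ge0.
(* K exceeds the bound [n * |a0|] on th a0 for th of norm 1, so replacing s + t a0 by s costs at
   most t K <= e. *)
pose t := Num.min 1 (e / K).
have t0 : 0 < t by rewrite lt_min ltr01 divr_gt0.
have t1 : t <= 1 by rewrite ge_min lexx.
have teK : t * K <= e by rewrite -ler_pdivlMr// ge_min lexx orbT.
have t01 : 0 < t <= 1 by rewrite t0.
have [p [Sp px sep]] := convex_separation cS vS (ex_intro _ 0 S0) (nS t t01).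
move: px sep; rewrite opprK -subr_eq0 opprK; set d := p + t *: a0 => d0 sep.
have nd0 : 0 < `|d| by rewrite normr_gt0.
have dA : (`|d|^-1 *: d <= A)%MS.
  by apply: scalemx_sub; apply: addmx_sub; [|apply: scalemx_sub]; exact: SA.
have nd1 : `| `|d|^-1 *: d| = 1.
  by rewrite normrZ normfV normr_id mulVf// lt0r_neq0.
exists (`|d|^-1 *: d) => // s Ss.
have h : 0 <= dot (`|d|^-1 *: d) (s + t *: a0).
  rewrite dotZl mulr_ge0 ?invr_ge0//; have := sep s Ss.
  by apply: le_trans; exact: dot_ge0.
have h2 := dot_abs_le (`|d|^-1 *: d) a0; rewrite nd1 mul1r in h2.
have h3 := le_trans (ler_norm _) h2.
move: h; rewrite dotDr dotZr => h; rewrite /K in teK.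
by nra.
Qed.

(** Induction on the rank of A: a functional th1 nonnegative on S cuts out a subset of smaller span,
    on which th2 is positive at distance rho; then t th1 + th2 works on all of S for t large. *)
Lemma extreme_slice (A : 'M[R]_n) S rho :
  closed S -> convex_subset S -> S 0 -> 0 < rho ->
  (forall s, S s -> (s <= A)%MS) -> (forall s, S s -> S (- s) -> s = 0) ->
  exists th, forall s, S s -> `|s| = rho -> 0 < dot th s.
Proof.
have [k] := ubnP (\rank A); elim: k A S => // k IHk A S.
rewrite ltnS => rkA cS vS S0 rho0 SA extS.
have [[a0 Sa0 a00]|noa] := pselect (exists2 a0, S a0 & a0 != 0); last first.
  exists 0 => s Ss sr; exfalso; apply: noa; exists s => //.
  by rewrite -normr_gt0 sr.
have [th1 [th1A th10 th1S]] := support_at_extreme cS vS S0 SA extS Sa0 a00.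
pose S' := S `&` [set s | dot th1 s = 0].
pose A' := (A :&: kermx th1^T)%MS.
have cd (th : 'rV[R]_n) : continuous (fun s => dot th s).
  by apply: coord_cont_dot; [exact: coord_cont_cst|exact: coord_cont_id].
have ker s : (s <= kermx th1^T)%MS = (dot th1 s == 0).
  rewrite sub_kermx (mx11_scalar (s *m _)) -scalemx1 scaler_eq0 oner_eq0 orbF.
  by congr (_ == 0); rewrite dotC mxE; apply: eq_bigr => i _; rewrite mxE.
have [th2 th2S] : exists th, forall s, S' s -> `|s| = rho -> 0 < dot th s.
  apply: (IHk A') => //.
  - apply: leq_trans rkA; apply: rank_ltmx; rewrite ltmxE capmxSl/=.
    apply/negP => /(submx_trans th1A); rewrite sub_capmx ker.
    by move=> /andP[_ /eqP /dot_eq0 h]; rewrite h eqxx in th10.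
  - by apply: closedI => //; exact: closed_level.
  - move=> a b t [Sa /= a1] [Sb /= b1] t01; split; first exact: vS.
    by rewrite /= !dotE a1 b1; ring.
  - by split => //=; rewrite dot0r.
  - by move=> s [Ss /= s1]; rewrite sub_capmx SA//= ker s1.
  - by move=> s [Ss _] [Ns _]; exact: extS.
have [t t0 tP] := compact_penalty (compact_sphere (r := rho) cS) (cd th1) (cd th2)
   (fun s h => th1S s h.1) (fun s h e => th2S s (conj h.1 e) h.2).
exists (t *: th1 + th2) => s Ss sr.
by rewrite dotDl dotZl; apply: tP.
Qed.

End Slices.

(** * Faces and exposed faces *)

Section Faces.
Context {R : realType} {n : nat}.
Implicit Types (x y z v : 'rV[R]_n).

(** For z in a convex cone C, these directions form the linear span of the smallest face of C
    through z. *)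
Definition face_dir (C : set 'rV[R]_n) z v :=
  exists2 e, 0 < e & C (z + e *: v) /\ C (z - e *: v).

(* The rows of [face_mx C z] span the smallest face of [C] containing [z]. *)
Definition face_mx (C : set 'rV[R]_n) z : 'M[R]_n :=
  xget 0 [set B : 'M[R]_n | forall v, face_dir C z v <-> (v <= B)%MS].

Variable C : set 'rV[R]_n.
Hypotheses (convC : convex_cone C) (C0 : C 0).

Let CD := coneD convC.
Let CZ := coneZ convC C0.

Lemma cone_mid x y : C x -> C y -> C (2^-1 *: (x + y)).
Proof. by move=> Cx Cy; apply: CZ; [rewrite invr_ge0 | exact: CD]. Qed.

Lemma cone_direction_add z u v e e' : C z -> 0 < e -> 0 < e' ->
  C (z + e *: u) -> C (z + e' *: v) ->
  exists2 d, 0 < d & C (z + d *: (u + v)).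
Proof.
move=> Cz e0 e'0 Cu Cv; pose d := Num.min e e'.
have d0 : 0 < d by rewrite lt_min e0.
exists (d / 2); first by rewrite divr_gt0.
have Cu' : C (z + d *: u).
  by apply: (cone_direction_le convC Cz Cu); rewrite (ltW d0) ge_min lexx.
have Cv' : C (z + d *: v).
  by apply: (cone_direction_le convC Cz Cv); rewrite (ltW d0) ge_min lexx orbT.
have := cone_mid Cu' Cv'.
have -> // : 2^-1 *: (z + d *: u + (z + d *: v)) = z + (d / 2) *: (u + v).
by apply/rowP => i; rewrite !mxE; field.
Qed.

Lemma face_dirD z u v : C z -> face_dir C z u -> face_dir C z v ->
  face_dir C z (u + v).
Proof.
move=> Cz [e e0 [eu eu']] [e' e'0 [ev ev']].
have [d d0 Cd] := cone_direction_add Cz e0 e'0 eu ev.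
rewrite -!scalerN in eu' ev'.
have [d' d'0 Cd'] := cone_direction_add Cz e0 e'0 eu' ev'.
pose m := Num.min d d'; have m0 : 0 < m by rewrite lt_min d0.
exists m => //; rewrite -scalerN; split.
  by apply: (cone_direction_le convC Cz Cd); rewrite (ltW m0) ge_min lexx.
apply: (cone_direction_le convC Cz (e := d')); first by rewrite opprD.
by rewrite (ltW m0) ge_min lexx orbT.
Qed.

Lemma face_dirZ z a v : C z -> face_dir C z v -> face_dir C z (a *: v).
Proof.
move=> Cz [e e0 [ev ev']].
have [->|a0] := eqVneq a 0.
  by exists 1 => //; rewrite scale0r scaler0 addr0 subr0.
have na : 0 < `|a| by rewrite normr_gt0.
exists (e / `|a|); first by rewrite divr_gt0.
rewrite !scalerA; have [a_ge|a_lt] := leP 0 a.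
  by rewrite ger0_norm// divfK//.
by rewrite ltr0_norm// invrN mulrN mulNr divfK// scaleNr opprK.
Qed.

Lemma face_mxP z v : C z -> face_dir C z v <-> (v <= face_mx C z)%MS.
Proof.
move=> Cz; rewrite /face_mx; case: xgetP => [B _ HB|]; first exact: HB.
have [||B HB] := @subspace_matrix R n (face_dir C z).
- by exists 1 => //; rewrite scaler0 addr0 subr0.
- by move=> a u w fu fw; apply: face_dirD => //; exact: face_dirZ.
by move=> /(_ B).
Qed.

Lemma order_unit_face z : C z -> order_unit C z <-> row_full (face_mx C z).
Proof.
move=> Cz; split=> [uz|fz v].
  rewrite -sub1mx; apply/row_subP => i; apply/face_mxP => //.
  have [e e0 h] := uz (row i 1%:M); have [e' e'0 h'] := uz (- row i 1%:M).
  pose m := Num.min e e'; have m0 : 0 < m by rewrite lt_min e0.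
  exists m => //; rewrite -scalerN; split.
    by apply: (cone_direction_le convC Cz h); rewrite (ltW m0) ge_min lexx.
  by apply: (cone_direction_le convC Cz h'); rewrite (ltW m0) ge_min lexx orbT.
have /face_mxP[//|e e0 [h _]] : (v <= face_mx C z)%MS by exact: submx_full.
by exists e.
Qed.

Lemma mem_face_mx z : C z -> (z <= face_mx C z)%MS.
Proof.
move=> Cz; apply/face_mxP => //; exists 1 => //.
by rewrite scale1r subrr; split => //; exact: CD.
Qed.

Lemma cone_face_sub z c : C z -> (c <= face_mx C z)%MS ->
  exists2 e, 0 < e & C (z - e *: c).
Proof. by move=> Cz /face_mxP[//|e e0 [_ h]]; exists e. Qed.

Lemma cone_face_subP z c e : C z -> C c -> 0 < e -> C (z - e *: c) ->
  (c <= face_mx C z)%MS.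
Proof.
move=> Cz Cc e0 h; apply/face_mxP => //; exists e => //; split => //.
by apply: CD => //; apply: CZ => //; exact: ltW.
Qed.

(** If z - e y and y + d v, y - d v are in C, then so are z + e d v and z - e d v, being (z - e y) +
    e (y + d v) and (z - e y) + e (y - d v). *)
Lemma face_mx_sub y z : C y -> C z -> (y <= face_mx C z)%MS ->
  (face_mx C y <= face_mx C z)%MS.
Proof.
move=> Cy Cz /face_mxP[//|e e0 [_ h]].
apply/rV_subP => v /face_mxP[//|d d0 [dv dv']]; apply/face_mxP => //.
exists (e * d); first exact: mulr_gt0.
have e0' := ltW e0; rewrite -scalerA; split.
  by have := CD h (CZ e0' dv); rewrite scalerDr addrA subrK.
by have := CD h (CZ e0' dv'); rewrite scalerBr addrA subrK.
Qed.

Hypothesis closedC : closed C.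

(* Straszewicz-Asplund: [y] minimizes over the cone near [z] a quadratic
   function which is convex along the face of [z] and concave across it, so that
   the derivative at [y] supports [C] and its zeros lie in the face of [y]. *)
Lemma exposed_face_near z1 z : C z1 -> C z ->
  ~ order_unit C z -> order_unit C (z1 + z) ->
  (forall y, C y -> ~ order_unit C y -> order_unit C (z1 + y) ->
    (\rank (face_mx C z) <= \rank (face_mx C y))%N) ->
  exists y f, [/\ C y, ~ order_unit C y, order_unit C (z1 + y) &
    \rank (face_mx C y) = \rank (face_mx C z)] /\
    [/\ dual_cone C f, dot f y = 0 &
      forall c, C c -> dot f c = 0 -> (c <= face_mx C y)%MS].
Proof.
move=> Cz1 Cz nuz uz1z minz.
(* Displacements from z split into a part along the face ([Pl]) and a part across it ([Pa]). *)
pose L := face_mx C z; pose Lc := (L^C)%MS.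
have LLc : (L :&: Lc)%MS = 0 by exact: capmx_compl.
have LcL : (Lc :&: L)%MS = 0 by rewrite capmxC.
pose Pl := proj_mx L Lc; pose Pa := proj_mx Lc L.
have PlPa v : v *m Pl + v *m Pa = v.
  by apply: add_proj_mx => //; apply: submx_full; exact: addsmx_compl_full.
have [r r0 hr] := order_unit_ball convC C0 uz1z.
(* Half of the radius is spent on moving z to y, the other half on the direction tested at z1 +
   y. *)
pose rho := r / 2; have rho0 : 0 < rho by rewrite divr_gt0.
have near_unit y : `|y - z| <= rho -> order_unit C (z1 + y).
  move=> yr v; have v0 : 0 < `|v| + 1 by rewrite ltr_wpDl.
  exists (rho / (`|v| + 1)); first by rewrite divr_gt0.
  have -> : z1 + y + (rho / (`|v| + 1)) *: v =
      (z1 + z) + ((y - z) + (rho / (`|v| + 1)) *: v).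
    by rewrite [RHS]addrA [z1 + z + _]addrACA subrr addr0.
  apply: hr; apply: (le_trans (ler_normD _ _)).
  have : `|(rho / (`|v| + 1)) *: v| <= rho.
    rewrite normrZ ger0_norm; last by rewrite divr_ge0 ?ltW.
    by rewrite mulrAC ler_pdivrMr// ler_pM2l// lerDl.
  by rewrite /rho; move: yr; rewrite /rho; lra.
(* The slice of C through z across its face: z is extreme in it, so some th is positive on the slice
   at distance rho. *)
pose S := [set a | (a <= Lc)%MS /\ C (z + a)].
have cS : closed S.
  have -> : S = [set a | (a <= Lc)%MS] `&` ((fun a => z + a) @^-1` C) by [].
  apply: closedI; first exact: closed_rowspace.
  apply: preimage_closed => // a _.
  by apply: coord_cont_continuous; apply: coord_contD;
    [exact: coord_cont_cst | exact: coord_cont_id].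
have vS : convex_subset S.
  move=> a b t [aL Ca] [bL Cb] t01; split.
    by apply: addmx_sub => //; apply: scalemx_sub; apply: addmx_sub; rewrite ?eqmx_opp.
  have := cone_convex convC Ca Cb t01.
  have -> : z + b - (z + a) = b - a by rewrite opprD addrACA subrr add0r.
  by rewrite addrA.
have S0 : S 0 by split; [exact: sub0mx | rewrite addr0].
have extS a : S a -> S (- a) -> a = 0.
  move=> [aL Ca] [_ Ca']; apply/eqP; rewrite -submx0 -LLc sub_capmx aL andbT.
  by apply/face_mxP => //; exists 1 => //; rewrite scale1r.
have [th thS] := extreme_slice cS vS S0 rho0 (fun s h => h.1) extS.
pose qa v := dot (v *m Pa) (v *m Pa); pose ql v := dot (v *m Pl) (v *m Pl).
have cth : continuous (fun v => dot th v).
  by apply: coord_cont_dot; [exact: coord_cont_cst | exact: coord_cont_id].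
have cqa : continuous qa.
  by apply: coord_cont_dot; apply: coord_cont_mulmx; exact: coord_cont_id.
have [T T0 hT] : exists2 T, 0 <= T &
    forall a, (S `&` [set a | `|a| = rho]) a -> 0 < T * dot th a + - qa a.
  apply: compact_penalty => //.
  - exact: compact_sphere.
  - have -> : (fun a => - qa a) = (fun a => -1 * qa a).
      by apply/funext => a; rewrite mulN1r.
    exact: continuous_mulf.
  - by move=> a [Sa /= na]; apply: ltW; exact: thS.
  - by move=> a [Sa /= na] h; have := thS a Sa na; rewrite h ltxx.
have cB : coord_cont (fun y : 'rV[R]_n => y - z).
  by apply: coord_contB; [exact: coord_cont_id | exact: coord_cont_cst].
have cql : continuous (fun y => ql (y - z)).
  by apply: coord_cont_dot; exact: coord_cont_mulmx.
have cqaz : continuous (fun y => qa (y - z)).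
  by apply: coord_cont_dot; exact: coord_cont_mulmx.
have cthz : continuous (fun y => dot th (y - z)).
  by apply: coord_cont_dot => //; exact: coord_cont_cst.
have cga : continuous (fun y => T * dot th (y - z) - qa (y - z)).
  by apply: continuous_subf => //; exact: continuous_mulf.
(* T handles the points of the sphere straight across the face, where [ql] vanishes; a large M
   handles all the others. *)
have [M M0 hM] : exists2 M, 0 <= M & forall y,
    (C y /\ `|y - z| <= rho) /\ `|y - z| = rho ->
    0 < M * ql (y - z) + (T * dot th (y - z) - qa (y - z)).
  apply: (@compact_penalty _ _ (fun y => ql (y - z)) _
    [set y | (C y /\ `|y - z| <= rho) /\ `|y - z| = rho]) => //.
  - have -> : [set y | (C y /\ `|y - z| <= rho) /\ `|y - z| = rho] =
      [set y | C y /\ `|y - z| <= rho] `&` [set y | `|y - z| = rho] by [].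
    apply: compact_closedI; first exact: compact_setI_ball.
    by apply: closed_level; exact: continuous_norm_sub.
  - by move=> y _; exact: dot_ge0.
  - move=> y [[Cy _] ny] /dot_eq0 yl.
    apply: hT; split => //=; split; last by rewrite addrC subrK.
    by rewrite -(PlPa (y - z)) yl add0r; exact: proj_mx_sub.
(* W is 0 at z and positive on the sphere, so its minimum over the part of C in the ball is reached
   strictly inside the ball. *)
pose W y := M * ql (y - z) + (T * dot th (y - z) - qa (y - z)).
have cW : continuous W.
  by apply: continuous_addf => //; exact: continuous_mulf.
have Wz : W z = 0 by rewrite /W /ql /qa subrr !mul0mx !dot0l dot0r !mulr0 subr0 addr0.
have Dz : C z /\ `|z - z| <= rho by rewrite subrr normr0 ltW.
have [y [Cy yr] ymin] :=
  compact_argmin (ex_intro _ z Dz) (@compact_setI_ball _ _ C z rho closedC) cW.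
have ylt : `|y - z| < rho.
  rewrite lt_neqAle yr andbT; apply/eqP => yrho.
  by have := hM y (conj (conj Cy yr) yrho); have := ymin z Dz; rewrite Wz /W; lra.
pose q v := M * ql v - qa v.
(* F is the gradient of W at y and q its quadratic part, so that the expansion [WD] is exact. *)
pose F := (2 * M) *: ((y - z) *m Pl *m Pl^T) + T *: th
          - 2 *: ((y - z) *m Pa *m Pa^T).
have WD t v : W (y + t *: v) = W y + t * (dot F v + t * q v).
  have -> : W (y + t *: v) = M * ql ((y - z) + t *: v) +
      (T * dot th ((y - z) + t *: v) - qa ((y - z) + t *: v)).
    by rewrite /W (addrAC y).
  rewrite /q /F /W /ql /qa; move: (y - z) => d.
  rewrite !dotE !(dotC (_ *m _ *m _)) -!dot_mulmxr !mulmxDl -!scalemxAl !dotE.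
  rewrite (dotC (v *m Pl) (d *m Pl)) (dotC (v *m Pa) (d *m Pa)). ring.
have feas v e : 0 < e -> C (y + e *: v) ->
    0 <= dot F v /\ (dot F v = 0 -> 0 <= q v).
  move=> e0 Cv.
  pose t0 := Num.min e ((rho - `|y - z|) / (`|v| + 1)).
  have v1 : 0 < `|v| + 1 by rewrite ltr_wpDl.
  have t00 : 0 < t0 by rewrite lt_min e0 divr_gt0// subr_gt0.
  have small t : 0 < t <= t0 -> 0 <= dot F v + t * q v.
    move=> /andP[tp tt].
    have Dt : C (y + t *: v) /\ `|y + t *: v - z| <= rho.
      split.
        apply: (cone_direction_le convC Cy Cv).
        by rewrite (ltW tp) (le_trans tt)// ge_min lexx.
      rewrite addrAC; apply: (le_trans (ler_normD _ _)).
      rewrite normrZ gtr0_norm// -lerBrDl.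
      have h : t * (`|v| + 1) <= rho - `|y - z|.
        by rewrite -ler_pdivlMr// (le_trans tt)// ge_min lexx orbT.
      by apply: le_trans h; rewrite ler_pM2l// lerDl.
    by have := ymin _ Dt; rewrite WD lerDl pmulr_rge0.
  split=> [|F0]; last first.
    by have := small t0; rewrite t00 lexx F0 add0r pmulr_rge0//; apply.
  rewrite leNgt; apply/negP => Fn.
  have k0 : 0 < 2 * (`|q v| + 1) by rewrite mulr_gt0// ltr_wpDl.
  pose t := Num.min t0 (- dot F v / (2 * (`|q v| + 1))).
  have tp : 0 < t by rewrite lt_min t00 divr_gt0// oppr_gt0.
  have tt : t <= t0 by rewrite ge_min lexx.
  have tF : t * (2 * (`|q v| + 1)) <= - dot F v.
    by rewrite -ler_pdivlMr// ge_min lexx orbT.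
  have := small t; rewrite tp tt => /(_ isT).
  have := ler_norm (q v); nra.
have dF : dual_cone C F.
  move=> c Cc; have [] // := feas c 1 ltr01.
  by rewrite scale1r; exact: CD.
have Fy : dot F y = 0.
  apply/eqP; rewrite eq_le dF// andbT -oppr_ge0 -dotNr.
  by have [] // := feas (- y) 1 ltr01; rewrite scale1r subrr.
have faceF v : (v <= face_mx C y)%MS -> dot F v = 0 /\ 0 <= q v.
  move=> /face_mxP[//|e e0 [h h']].
  have [F1 F2] := feas v e e0 h; rewrite -scalerN in h'.
  have [F1' _] := feas _ e e0 h'; rewrite dotNr in F1'.
  have F0 : dot F v = 0 by lra.
  by split => //; exact: F2.
(* Since q is nonnegative on the face directions at y, [Pl] is injective on them: the face of y has
   rank at most that of z, hence the same rank by minimality. *)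
have q0 v : 0 <= q v -> v *m Pl = 0 -> v = 0.
  rewrite /q /ql /qa => qv vl; rewrite vl dot0l mulr0 sub0r oppr_ge0 in qv.
  have /dot_eq0 va : dot (v *m Pa) (v *m Pa) = 0.
    by apply/eqP; rewrite eq_le qv dot_ge0.
  by rewrite -(PlPa v) vl va addr0.
have rkT : \rank (face_mx C y *m Pl) = \rank (face_mx C y).
  rewrite -[RHS](mxrank_mul_ker _ Pl).
  suff -> : (face_mx C y :&: kermx Pl)%MS = 0 by rewrite mxrank0 addn0.
  apply/eqP; rewrite -submx0; apply/rV_subP => v; rewrite sub_capmx.
  move=> /andP[/faceF[_ qv]]; rewrite sub_kermx => /eqP vl.
  by rewrite (q0 v)// sub0mx.
have PlL : (face_mx C y *m Pl <= L)%MS by exact: proj_mx_sub.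
have rkle : (\rank (face_mx C y) <= \rank L)%N by rewrite -rkT mxrankS.
have nuy : ~ order_unit C y.
  move/(order_unit_face Cy); rewrite /row_full => /eqP fy; apply: nuz.
  apply/(order_unit_face Cz); rewrite /row_full eqn_leq rank_leq_col.
  by rewrite -{1}fy.
have uy : order_unit C (z1 + y) by exact: near_unit.
have rkE : \rank (face_mx C y) = \rank L.
  by apply/eqP; rewrite eqn_leq rkle minz.
exists y, F; split; split=> // c Cc Fc.
have LPl : (L <= face_mx C y *m Pl)%MS.
  by have [_ <-] := mxrank_leqif_sup PlL; rewrite rkT rkE.
(* With equal ranks, some tau in the span of the face of y has the same projection to L as c. The
   direction c - tau is feasible with zero derivative, so q is nonnegative at it, and [q0] gives c =
   tau. *)
have /submxP[D cD] : (c *m Pl <= face_mx C y *m Pl)%MS.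
  by apply: submx_trans LPl; exact: proj_mx_sub.
pose tau := D *m face_mx C y.
have tauT : (- tau <= face_mx C y)%MS by rewrite eqmx_opp submxMl.
have [e e0 [h _]] := (face_mxP (- tau) Cy).2 tauT.
have Cc1 : C (y + 1 *: c) by rewrite scale1r; exact: CD.
have [d d0 Cd] := cone_direction_add Cy ltr01 e0 Cc1 h.
have [_ qd] := feas _ d d0 Cd.
have : c - tau = 0.
  apply: q0; last by rewrite mulmxBl -mulmxA -cD subrr.
  by apply: qd; rewrite dotDr Fc (faceF _ tauT).1 addr0.
by move/subr0_eq ->; exact: submxMl.
Qed.

End Faces.

(** * The sandwiching of a cone with two complementary faces *)

Section Core.
Context {R : realType} {n : nat}.
Implicit Types (x y z v g f u : 'rV[R]_n).

(* A kite-square sandwiching up to scaling: [g1], [g3], [g2] and [g4] are the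
   functionals t - x, t + x, t - y and t + y composed with [Phi], and [v1], ..., [v4]
   are multiples of the images of the vertices of the kite under [Psi]. *)
Definition sandwich (C : set 'rV[R]_n) : Prop :=
  exists g1 g2 g3 g4 v1 v2 v3 v4,
    [/\ [/\ dual_cone C g1, dual_cone C g2, dual_cone C g3 & dual_cone C g4],
        [/\ C v1, C v2, C v3 & C v4],
        [/\ g1 + g3 = g2 + g4 & v1 + v3 = v2 + v4],
        [/\ dot g1 v1 = 0, dot g2 v2 = 0, dot g3 v3 = 0 & dot g4 v4 = 0] &
        (forall c, C c -> dot g1 c = 0 \/ dot g3 c = 0 ->
          dot g2 c = 0 \/ dot g4 c = 0 -> dot (g1 + g3) c = 0) /\
        [/\ 0 < dot (g1 + g3) v1, 0 < dot (g1 + g3) v2,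
            0 < dot (g1 + g3) v3 & 0 < dot (g1 + g3) v4]].

Variable C : set 'rV[R]_n.
Hypotheses (convC : convex_cone C) (C0 : C 0) (closedC : closed C).

Let CD := coneD convC.
Let CZ := coneZ convC C0.

Lemma segment_exit x y : C x -> ~ C y ->
  exists t, [/\ 0 <= t < 1, C (x + t *: (y - x)) &
    forall s, t < s -> ~ C (x + s *: (y - x))].
Proof.
move=> Cx Cy.
pose X := `[0, 1]%classic `&` [set t : R | C (x + t *: (y - x))].
have cX : compact X.
  apply: compact_closedI; first exact: segment_compact.
  have cf : continuous (fun t : R => x + t *: (y - x)).
    apply: coord_cont_continuous => j.
    under eq_fun do rewrite !mxE.
    move=> s; apply: cvgD; first exact: cvg_cst.
    by apply: cvgM; [exact: cvg_id | exact: cvg_cst].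
  have -> : [set t : R | C (x + t *: (y - x))] =
    (fun t : R => x + t *: (y - x)) @^-1` C by [].
  by apply: preimage_closed => // t _; exact: cf.
have X0 : X 0 by split; rewrite /= ?in_itv/= ?lexx ?ler01// scale0r addr0.
have [t [t01 Ct] tmax] := compact_argmax (ex_intro _ 0 X0) cX (fun t => cvg_id).
move: t01; rewrite /= in_itv/= => /andP[t0 t1].
(* By convexity a point of C at or beyond y would put y in C; hence the maximum over [0, 1] is the
   exit from C on the whole ray. *)
have C1 s : C (x + s *: (y - x)) -> s < 1.
  move=> Cs; rewrite ltNge; apply/negP => s1; apply: Cy.
  have := cone_direction_le convC Cx Cs (e' := 1).
  by rewrite ler01 s1 scale1r addrC subrK; apply.
exists t; split => //; first by rewrite t0 C1.
move=> s ts Cs; have : s <= t.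
  by apply: tmax; split => //=; rewrite in_itv/= (ltW (C1 _ Cs)) andbT (le_trans t0)// ltW.
by rewrite leNgt ts.
Qed.

Lemma dual_face_eq0 g z v : C z -> dual_cone C g -> dot g z = 0 ->
  (v <= face_mx C z)%MS -> dot g v = 0.
Proof.
move=> Cz Dg gz /(face_mxP convC C0 _ Cz)[e e0 [/Dg h /Dg h']].
move: h h'; rewrite !dotE gz !add0r oppr_ge0 pmulr_rge0// pmulr_rle0// => h h'.
by apply/eqP; rewrite eq_le h h'.
Qed.

(* The segment from [z3] to [b] leaves [C] at a point of a smaller face, which
   by minimality lies together with [z1] in a proper exposed face of [C]. *)
Lemma minimal_pair_mem z1 z3 a b : C z1 -> C z3 ->
  order_unit C (z1 + z3) -> ~ order_unit C z3 ->
  (forall z, C z -> ~ order_unit C z -> order_unit C (z1 + z) ->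
    (\rank (face_mx C z3) <= \rank (face_mx C z))%N) ->
  (a <= face_mx C z1)%MS -> (b <= face_mx C z3)%MS -> C (a + b) -> C b.
Proof.
move=> Cz1 Cz3 uz nuz3 minz az1 bz3 Cab; apply: contrapT => Cb.
have [t [/andP[t0 t1] Cz' exit]] := segment_exit Cz3 Cb.
set z' := z3 + t *: (b - z3) in Cz'.
have bz : (b - z3 <= face_mx C z3)%MS.
  by apply: addmx_sub => //; rewrite eqmx_opp; exact: mem_face_mx.
have z'3 : (z' <= face_mx C z3)%MS.
  by apply: addmx_sub; [exact: mem_face_mx | exact: scalemx_sub].
have sub3 := face_mx_sub convC C0 Cz' Cz3 z'3.
have nuz' : ~ order_unit C z'.
  move=> /(order_unit_face convC C0 Cz') fz'; apply: nuz3.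
  by apply/(order_unit_face convC C0 Cz3); rewrite -sub1mx (submx_trans _ sub3)// sub1mx.
(* Otherwise minimality makes the face of z' as large as that of z3, so the segment could be
   prolonged inside C past its exit point. *)
have nu : ~ order_unit C (z1 + z').
  move=> /(minz z' Cz' nuz') rk.
  have : (b - z3 <= face_mx C z')%MS.
    apply: submx_trans bz _.
    by have [_ <-] := mxrank_leqif_sup sub3; rewrite eqn_leq rk mxrankS.
  move=> /(face_mxP convC C0 _ Cz')[e e0 [h _]].
  apply: (exit (t + e)); first by rewrite ltrDl.
  by rewrite scalerDl addrA.
(* An order unit k (z1 + z') with k <= 0 would make 0 an order unit, hence C the whole space,
   although b is not in C. *)
have noM (w : 'rV_1) : ~ order_unit C (w *m (z1 + z')).
  rewrite (mx11_scalar w) mul_scalar_mx; set k := w 0 0 => uk.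
  have [k0|k0] := ltP 0 k.
    apply: nu; have := order_unitZ convC C0 (a := k^-1) _ uk.
    by rewrite scalerA mulVf ?lt0r_neq0// scale1r invr_gt0; apply.
  have Ck : C ((- k) *: (z1 + z')) by apply: CZ; [rewrite oppr_ge0 | exact: CD].
  have := order_unitD convC uk Ck.
  rewrite -scalerDl subrr scale0r => /(_ b)[e e0]; rewrite add0r => Ceb.
  apply: Cb; rewrite -(scale1r b) -(mulVf (lt0r_neq0 e0)) -scalerA.
  by apply: CZ => //; rewrite invr_ge0 ltW.
have [g [Dg g0 gM]] := support_subspace convC C0 closedC uz noM.
have gz : dot g z1 + dot g z' = 0.
  by have := gM 1%:M; rewrite mul1mx dotDr.
have g1 : dot g z1 = 0 by have := Dg _ Cz1; have := Dg _ Cz'; lra.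
have g' : dot g z' = 0 by lra.
(* On the line from z3 to b, g is positive at z3 and zero at z', which comes before b: so g b < 0,
   while g (a + b) = g b must be nonnegative. *)
have g3 : 0 < dot g z3.
  by have := dual_order_unit_gt0 uz Dg g0; rewrite dotDr g1 add0r.
have ga := dual_face_eq0 Cz1 Dg g1 az1.
have := Dg _ Cab; rewrite dotDr ga add0r.
by move: g'; rewrite /z' !dotE; nra.
Qed.

(** * Duality modulo a subspace through the interior *)

Section Balance.
Variables (u : 'rV[R]_n) (N : 'M[R]_n) (e : 'rV[R]_n).
Hypotheses (Du : dual_cone C u) (u0 : forall c, C c -> dot u c = 0 -> c = 0).
Hypotheses (ue : order_unit C e) (eN : (e <= N)%MS).

Let cdot g : continuous (fun x => dot g x).
Proof. by apply: coord_cont_dot; [exact: coord_cont_cst | exact: coord_cont_id]. Qed.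

Lemma positive_functional_bound : exists2 d, 0 < d & forall c, C c -> d * `|c| <= dot u c.
Proof.
have cX := compact_sphere (r := 1) closedC.
have [X0|/set0P Xn0] := eqVneq (C `&` [set x | `|x| = 1]) set0.
  exists 1 => // c Cc; have [->|c0] := eqVneq c 0; first by rewrite normr0 dot0r mulr0.
  have nc : 0 < `|c| by rewrite normr_gt0.
  have : (C `&` [set x | `|x| = 1]) (`|c|^-1 *: c).
    split; first by apply: CZ => //; rewrite invr_ge0.
    by rewrite /= normrZ normfV normr_id mulVf// lt0r_neq0.
  by rewrite X0.
have [x [Cx /= x1] xmin] := compact_argmin Xn0 cX (@cdot u).
exists (dot u x).
  rewrite lt_neqAle Du// andbT; apply/eqP => /esym/u0 => /(_ Cx) x0.
  by move: x1; rewrite x0 normr0 => /esym/eqP; rewrite oner_eq0.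
move=> c Cc; have [->|c0] := eqVneq c 0; first by rewrite normr0 dot0r mulr0.
have nc : 0 < `|c| by rewrite normr_gt0.
have : (C `&` [set x | `|x| = 1]) (`|c|^-1 *: c).
  split; first by apply: CZ => //; rewrite invr_ge0.
  by rewrite /= normrZ normfV normr_id mulVf// lt0r_neq0.
by move/xmin; rewrite dotZr mulrC ler_pdivlMr.
Qed.

Lemma compact_cone_sublevel a (S : set 'rV[R]_n) : closed S ->
  compact [set c | (C c /\ S c) /\ dot u c <= a].
Proof.
move=> cS; have [d d0 hd] := positive_functional_bound.
apply: (@compact_bounded_in _ _ _ (a / d)).
  apply: (closedI (closedI closedC cS)); apply: closed_sublevel; exact: cdot.
by move=> c [[Cc _] ua]; rewrite ler_pdivlMr// mulrC (le_trans (hd c Cc)).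
Qed.

(* [v] minimizes [u] among the points of [C] congruent to [- y] modulo [N]. *)
Lemma dual_representative y : C y -> ~~ (y <= N)%MS ->
  exists v f, [/\ C v, dual_cone C f, ((v + y)%R <= N)%MS,
    forall x, (x <= N)%MS -> dot f x = dot u x & dot f v = 0].
Proof.
move=> Cy yN.
have ue0 : 0 < dot u e.
  rewrite lt_neqAle Du ?andbT; last exact: order_unit_mem.
  apply/eqP => /esym/u0 => /(_ (order_unit_mem ue)) e0.
  move/negP: yN; apply; have [d d0] := ue (- y).
  rewrite e0 add0r => /Du; rewrite dotZr dotNr pmulr_rge0// oppr_ge0 => h.
  by rewrite (u0 Cy) ?sub0mx//; apply/eqP; rewrite eq_le h Du.
pose S := [set v : 'rV[R]_n | ((v + y)%R <= N)%MS].
have cS : closed S.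
  apply: (@preimage_closed _ _ (fun v => v + y) [set x | (x <= N)%MS]).
    move=> v _; apply: coord_cont_continuous.
    by apply: coord_contD; [exact: coord_cont_id | exact: coord_cont_cst].
  exact: closed_rowspace.
have [d d0 Cd] := ue (- y).
pose v0 := d^-1 *: (e + d *: - y).
have Cv0 : C v0 by apply: CZ => //; rewrite invr_ge0 ltW.
have Sv0 : S v0.
  rewrite /S /= /v0 scalerDr scalerA mulVf ?lt0r_neq0// scale1r subrK.
  exact: scalemx_sub.
have [v [[Cv Sv] _] vmin0] := compact_argmin
  (ex_intro _ v0 (conj (conj Cv0 Sv0) (lexx (dot u v0))))
  (compact_cone_sublevel (a := dot u v0) cS) (@cdot u).
have vmin w : C w -> S w -> dot u v <= dot u w.
  move=> Cw Sw; have [h|/ltW h] := leP (dot u w) (dot u v0); first exact: vmin0.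
  apply: le_trans h; exact: vmin0.
(* For t > 0, x / t + v is again congruent to - y modulo N, so minimality of u at v applies; for t <
   0, adding - t v puts x itself in C. *)
have key x t : (x <= N)%MS -> C (x + t *: v) -> 0 <= dot u x.
  move=> xN Cx; have [t0|t0|t0] := ltgtP t 0.
  - have Cv' : C (- t *: v) by apply: CZ => //; rewrite oppr_ge0 ltW.
    by have /Du := CD Cx Cv'; rewrite scaleNr addrK.
  - have Cx' := CZ (ltW (divr_gt0 ltr01 t0)) Cx; rewrite div1r in Cx'.
    rewrite scalerDr scalerA mulVf ?lt0r_neq0// scale1r in Cx'.
    have /(vmin _ Cx') : S (t^-1 *: x + v).
      by rewrite /S /= -addrA; apply: addmx_sub => //; exact: scalemx_sub.
    by rewrite dotDr dotZr lerDr pmulr_rge0 ?invr_gt0.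
  - by move: Cx; rewrite t0 scale0r addr0 => /Du.
(* An order unit x + b v with x in N and u x = 0 would remain in C after subtracting a small s e,
   and [key] would give u (x - s e) >= 0. So this subspace misses the interior, and some g in the
   dual cone vanishes on it. *)
pose M := ((N :&: kermx u^T) + v)%MS.
have ker x : (x <= kermx u^T)%MS = (dot u x == 0).
  rewrite sub_kermx (mx11_scalar (x *m _)) -scalemx1 scaler_eq0 oner_eq0 orbF.
  by congr (_ == 0); rewrite dotC mxE; apply: eq_bigr => i _; rewrite mxE.
have noM w : ~ order_unit C (w *m M).
  have /sub_addsmxP[[a b] /= ->] : (w *m M <= (N :&: kermx u^T) + v)%MS by exact: submxMl.
  have : (a *m (N :&: kermx u^T) <= N :&: kermx u^T)%MS by exact: submxMl.
  move: (a *m _) => x; rewrite sub_capmx ker => /andP[xN /eqP ux].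
  rewrite (mx11_scalar b) mul_scalar_mx => uo.
  have [s s0 Cs] := uo (- e); rewrite addrAC in Cs.
  have xeN : ((x + s *: - e)%R <= N)%MS.
    by apply: addmx_sub => //; apply: scalemx_sub; rewrite eqmx_opp.
  have := key _ _ xeN Cs.
  by rewrite !dotE ux add0r mulrN oppr_ge0 pmulr_rle0// leNgt ue0.
have [g [Dg g0 gM]] := support_subspace convC C0 closedC ue noM.
have ge := dual_order_unit_gt0 ue Dg g0.
have gMx x : (x <= M)%MS -> dot g x = 0 by move=> /submxP[w ->].
(* On N both functionals vanish on the kernel of u; scaling makes them agree at e, where u is
   positive, hence on all of N. *)
exists v, ((dot u e / dot g e) *: g); split=> //.
- by move=> c Cc; rewrite dotZl; apply: mulr_ge0; [exact: ltW (divr_gt0 _ _) | exact: Dg].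
- move=> x xN.
  have := gMx (x - (dot u x / dot u e) *: e) _.
  rewrite dotBr dotZr => h; rewrite dotZl.
  have {h} : dot g x - dot u x / dot u e * dot g e = 0.
    apply: h; apply: submx_trans (addsmxSl _ _); rewrite sub_capmx ker.
    rewrite dotBr dotZr divfK ?lt0r_neq0// subrr eqxx andbT.
    apply: addmx_sub => //; rewrite eqmx_opp; exact: scalemx_sub.
  move/eqP; rewrite subr_eq0 => /eqP ->.
  by field; rewrite !lt0r_neq0.
- have vM : (v <= M)%MS by exact: addsmxSr.
  by rewrite dotZl (gMx _ vM) mulr0.
Qed.

Lemma balanced_functional : ~~ row_full N ->
  exists f r y v, [/\ [/\ C y, C v & dual_cone C f], ((y + v)%R <= N)%MS,
    (forall x, (x <= N)%MS -> dot f x = dot u x) /\ dot f v = 0,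
    0 < r /\ dot u y = 1 &
    dot (f - u) y = r /\ forall c, C c -> dot (f - u) c <= r * dot u c].
Proof.
move=> nfN.
pose FF := (dual_cone C `&` [set f | dot f e = dot u e]) `&`
   [set f | forall x, (x <= N)%MS -> dot f x = dot u x].
pose K := [set c | (C c /\ dot u c = 1) /\ dot u c <= 1].
have cF : compact FF.
  apply: compact_closedI; first exact: compact_dual_slice.
  have -> : [set f | forall x, (x <= N)%MS -> dot f x = dot u x] =
      \bigcap_(x in [set x | (x <= N)%MS]) [set f | dot f x = dot u x] by [].
  apply: closed_bigI => x _; apply: closed_level.
  by apply: coord_cont_dot; [exact: coord_cont_id | exact: coord_cont_cst].
have cK : compact K.
  by apply: compact_cone_sublevel; apply: closed_level; exact: cdot.
have Fu : FF u by [].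
(* If C were contained in N, its interior point e would force N to be full. *)
have [y1 Cy1 y1N] : exists2 y, C y & ~~ (y <= N)%MS.
  apply: contrapT => nE; move/negP: nfN; apply.
  rewrite -sub1mx; apply/row_subP => i; set w := row i _.
  have [d d0 Cd] := ue w.
  have : ((e + d *: w)%R <= N)%MS by apply/negPn/negP => h; apply: nE; exists (e + d *: w).
  move=> h; rewrite -(scale1r w) -(mulVf (lt0r_neq0 d0)) -scalerA; apply: scalemx_sub.
  have -> : d *: w = (e + d *: w) - e by rewrite addrAC subrr add0r.
  by apply: addmx_sub => //; rewrite eqmx_opp.
have uy1 : 0 < dot u y1.
  rewrite lt_neqAle Du// andbT; apply/eqP => /esym /(u0 Cy1) y10.
  by rewrite y10 sub0mx in y1N.
pose y2 := (dot u y1)^-1 *: y1.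
have Cy2 : C y2 by apply: CZ => //; rewrite invr_ge0 ltW.
have uy2 : dot u y2 = 1 by rewrite dotZr mulVf// lt0r_neq0.
have y2N : ~~ (y2 <= N)%MS.
  move: y1N; apply: contra => /(scalemx_sub (dot u y1)).
  by rewrite scalerA divff ?scale1r// lt0r_neq0.
have Ky2 : K y2 by rewrite /K /= uy2.
have cpair : continuous (fun p : 'rV[R]_n * 'rV[R]_n => dot (p.1 - u) p.2).
  apply: coord_cont_dot; last exact: coord_cont_snd.
  by apply: coord_contB; [exact: coord_cont_fst | exact: coord_cont_cst].
have [[f0 y0] /= [Ff0 [[Cy0 uy0] _]] maxp] :=
  compact_argmax (ex_intro _ (u, y2) (conj Fu Ky2)) (compact_setX cF cK) cpair.
have rep y : C y -> dot u y = 1 -> ~~ (y <= N)%MS -> exists v f,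
   [/\ C v, dual_cone C f & ((v + y)%R <= N)%MS] /\
   [/\ forall x, (x <= N)%MS -> dot f x = dot u x, dot f v = 0,
       0 < dot u v, dot (f - u) y = dot u v & dot (f - u) y <= dot (f0 - u) y0].
  move=> Cy uy yN; have [v [f [Cv Df vyN fN fv]]] := dual_representative Cy yN.
  have fy : dot (f - u) y = dot u v.
    by have := fN _ vyN; rewrite !dotE fv; lra.
  exists v, f; split; split => //.
    rewrite lt_neqAle Du// andbT; apply/eqP => /esym /(u0 Cv) v0.
    by move: vyN; rewrite v0 add0r (negbTE yN).
  apply: (maxp (f, y)); split => //=; first by split=> //; split => //; exact: fN.
  by rewrite /K /= uy.
(* One normalized point of C outside N is enough to make the maximum r positive. *)
have [v2 [f2 [_ [_ _ uv2 e2 le2]]]] := rep _ Cy2 uy2 y2N.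
pose r := dot (f0 - u) y0.
have r0 : 0 < r by rewrite /r; lra.
have y0N : ~~ (y0 <= N)%MS.
  by apply/negP => y0N; move: r0; rewrite /r dotBl Ff0.2// subrr ltxx.
have [v [f [[Cv Df vyN] [fN fv uv fy fr]]]] := rep _ Cy0 uy0 y0N.
(* Since f0 equals u at y0 + v and f0 v >= 0, the functional f built from y0 also reaches the
   maximum, and moreover vanishes at v. *)
have f0v : dot (f0 - u) y0 <= dot u v.
  have := Ff0.2 _ vyN; have := Ff0.1.1 _ Cv; rewrite !dotE; lra.
exists f, r, y0, v; split=> //; first by rewrite addrC.
split; first by rewrite /r; lra.
move=> c Cc; have [->|c0] := eqVneq c 0; first by rewrite !dot0r mulr0.
have uc : 0 < dot u c.
  rewrite lt_neqAle Du// andbT; apply/eqP => /esym /(u0 Cc) cc0.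
  by rewrite cc0 eqxx in c0.
have : dot (f - u) ((dot u c)^-1 *: c) <= r.
  apply: (maxp (f, (dot u c)^-1 *: c)); split => //=.
    by split=> //; split => //; exact: fN.
  rewrite /K /= dotZr mulVf ?lt0r_neq0//; split=> //; split => //.
  by apply: CZ => //; rewrite invr_ge0 ltW.
by rewrite dotZr mulrC ler_pdivrMr.
Qed.

End Balance.

Lemma sandwich_of_faces z1 z3 f1 f3 : C z1 -> C z3 -> order_unit C (z1 + z3) ->
  dual_cone C f1 -> dual_cone C f3 ->
  (forall c, C c -> dot f1 c = 0 <-> (c <= face_mx C z1)%MS) ->
  (forall c, C c -> dot f3 c = 0 <-> (c <= face_mx C z3)%MS) ->
  (face_mx C z1 :&: face_mx C z3 = 0)%MS ->
  (forall a b, (a <= face_mx C z1)%MS -> (b <= face_mx C z3)%MS ->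
    C (a + b) -> C a /\ C b) ->
  ~~ row_full (face_mx C z1 + face_mx C z3)%MS ->
  sandwich C.
Proof.
set L1 := face_mx C z1; set L3 := face_mx C z3; set N := (L1 + L3)%MS.
move=> Cz1 Cz3 ue D1 D3 Z1 Z3 cap0 dec nfull.
pose u := f1 + f3.
have Du : dual_cone C u by move=> c Cc; rewrite dotDl addr_ge0 ?D1 ?D3.
have u0 c : C c -> dot u c = 0 -> c = 0.
  move=> Cc; rewrite dotDl => uc; apply/eqP; rewrite -submx0 -cap0 sub_capmx.
  have h1 := D1 c Cc; have h3 := D3 c Cc.
  by apply/andP; split; [apply/(Z1 c Cc) | apply/(Z3 c Cc)]; lra.
have eN : ((z1 + z3)%R <= N)%MS.
  apply: addmx_sub.
    by apply: submx_trans (addsmxSl _ _); exact: mem_face_mx.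
  by apply: submx_trans (addsmxSr _ _); exact: mem_face_mx.
have [f [r [y [v [[Cy Cv Df] yvN [fN fv] [r0 uy] [fy fle]]]]]] :=
  balanced_functional Du u0 ue eN nfull.
have /sub_addsmxP[[A B] /= yvE] := yvN.
set a := A *m L1 in yvE; set b := B *m L3 in yvE.
have aL : (a <= L1)%MS by exact: submxMl.
have bL : (b <= L3)%MS by exact: submxMl.
have [Ca Cb] : C a /\ C b by apply: dec => //; rewrite -yvE; exact: CD.
have yN : ~~ (y <= N)%MS.
  by apply/negP => yN; move: r0; rewrite -fy dotBl fN// subrr ltxx.
have upos c : C c -> c != 0 -> 0 < dot u c.
  move=> Cc c0; rewrite lt_neqAle Du// andbT; apply/eqP => /esym /(u0 c Cc) cc0.
  by rewrite cc0 eqxx in c0.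
have v0 : v != 0 by apply/eqP => v0; move: yvN; rewrite v0 addr0 (negbTE yN).
(* If y + v were in the second face, f3 would vanish at y and v, both nonnegative terms, and y would
   lie in N. *)
have a0 : a != 0.
  apply/eqP => a0; move/negP: yN; apply.
  apply: submx_trans (addsmxSr _ _); apply/(Z3 y Cy).
  have /(Z3 b Cb) : (b <= L3)%MS by [].
  have -> : b = y + v by rewrite yvE a0 add0r.
  by rewrite dotDr; have := D3 y Cy; have := D3 v Cv; lra.
have b0 : b != 0.
  apply/eqP => b0; move/negP: yN; apply.
  apply: submx_trans (addsmxSl _ _); apply/(Z1 y Cy).
  have /(Z1 a Ca) : (a <= L1)%MS by [].
  have -> : a = y + v by rewrite yvE b0 addr0.
  by rewrite dotDr; have := D1 y Cy; have := D1 v Cv; lra.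
have y0 : y != 0 by apply/eqP => y0; rewrite y0 sub0mx in yN.
have r1 : 0 < 1 + r by lra.
have gE : (1 + r) *: f1 + (1 + r) *: f3 = (1 + r) *: u by rewrite scalerDr.
exists ((1 + r) *: f1), ((1 + r) *: u - f), ((1 + r) *: f3), f, a, y, b, v.
rewrite gE; split => //.
- split => // c Cc; rewrite !dotE.
  + by rewrite mulr_ge0 ?D1// ltW.
  + by have := fle c Cc; rewrite !dotE; lra.
  + by rewrite mulr_ge0 ?D3// ltW.
- by split; rewrite ?subrK.
- split => //.
  + by rewrite dotZl ((Z1 a Ca).2 aL) mulr0.
  + by move: fy; rewrite (dotBl ((1 + r) *: u)) (dotBl f) dotZl uy; lra.
  + by rewrite dotZl ((Z3 b Cb).2 bL) mulr0.
(* Vanishing of f1 or f3 puts c in N, where the two other functionals are r u and u. *)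
- split=> [c Cc c13 c24|].
    have cN : (c <= N)%MS.
      case: c13 => /eqP; rewrite dotZl mulf_eq0 gt_eqF//= => /eqP.
        by move=> /(Z1 c Cc) h; apply: submx_trans h (addsmxSl _ _).
      by move=> /(Z3 c Cc) h; apply: submx_trans h (addsmxSr _ _).
    rewrite dotZl; apply/eqP; rewrite mulf_eq0 gt_eqF//=; apply/eqP.
    case: c24; last by rewrite fN.
    rewrite dotBl dotZl fN// => /eqP; rewrite -[X in _ - X]mul1r -mulrBl addrAC subrr add0r.
    by rewrite mulf_eq0 gt_eqF// => /eqP.
  by split; rewrite dotZl mulr_gt0//; exact: upos.
Qed.

End Core.

(** * Induction on the dimension *)

Section Dichotomy.
Context {R : realType}.

(** The number m of generators is free, so that the generators of two factors can simply be
    stacked. *)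
Definition simplicial n (C : set 'rV[R]_n) : Prop :=
  exists m (B : 'M[R]_(m, n)), row_free B /\
    forall c, C c <-> exists2 x : 'rV_m, (forall i, 0 <= x 0 i) & c = x *m B.

Definition solid_cone n (C : set 'rV[R]_n) : Prop :=
  [/\ convex_cone C, closed C, C 0, (forall x, C x -> C (- x) -> x = 0) &
      exists e, order_unit C e].

(** Functionals are pulled back along P and points pushed forward along B; as [B *m P] is the
    identity, all pairings are preserved. *)
Lemma sandwich_retract n d (C : set 'rV[R]_n) (C' : set 'rV[R]_d)
    (B : 'M[R]_(d, n)) (P : 'M[R]_(n, d)) :
  B *m P = 1%:M -> (forall x, C' x -> C (x *m B)) ->
  (forall c, C c -> C' (c *m P)) -> sandwich C' -> sandwich C.
Proof.
move=> BP BC PC [g1 [g2 [g3 [g4 [v1 [v2 [v3 [v4 []]]]]]]]].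
move=> [D1 D2 D3 D4] [C1 C2 C3 C4] [gE vE] [z1 z2 z3 z4] [bl [p1 p2 p3 p4]].
have dE g c : dot (g *m P^T) c = dot g (c *m P).
  by rewrite dotC -dot_mulmxr dotC.
have dB g x : dot (g *m P^T) (x *m B) = dot g x.
  by rewrite dE -mulmxA BP mulmx1.
exists (g1 *m P^T), (g2 *m P^T), (g3 *m P^T), (g4 *m P^T).
exists (v1 *m B), (v2 *m B), (v3 *m B), (v4 *m B).
rewrite -!mulmxDl gE vE !dB; split => //.
- by split=> c /PC Cc; rewrite dE; [exact: D1|exact: D2|exact: D3|exact: D4].
- by split; exact: BC.
- by rewrite -gE; split=> // c /PC Cc; rewrite !dE; exact: bl.
Qed.

Section Step.
Context {n : nat}.
Variable C : set 'rV[R]_n.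
Hypotheses (convC : convex_cone C) (C0 : C 0) (closedC : closed C).
Hypothesis salC : forall x, C x -> C (- x) -> x = 0.

Lemma simplicial_ray e : order_unit C e ->
  (forall v, exists k, v = k *: e) -> simplicial C.
Proof.
move=> ue line; have Ce := order_unit_mem ue.
have [e0|e0] := eqVneq e 0.
  exists 0%N, 0; split; first by rewrite /row_free mxrank0.
  move=> c; split=> [_|[x _ ->]]; last by rewrite mulmx0.
  have [k ->] := line c; exists 0 => [i|]; first by rewrite mxE.
  by rewrite e0 scaler0 mulmx0.
exists 1%N, e; split; first by rewrite /row_free rank_rV e0.
move=> c; split=> [Cc|[x x0 ->]]; last first.
  by rewrite (mx11_scalar x) mul_scalar_mx; apply: coneZ.
have [k cE] := line c; have [k0|k0] := leP 0 k.
  exists k%:M => [i|]; first by rewrite (ord1 i) mxE eqxx mulr1n.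
  by rewrite mul_scalar_mx.
exists 0 => [i|]; first by rewrite mxE.
rewrite mul0mx; apply: salC => //; rewrite cE -scaleNr.
by apply: coneZ => //; rewrite oppr_ge0 ltW.
Qed.

(** Far in the direction e the line is inside C, and far in the direction - e it is outside, since
    otherwise - e would be a sum of two points of C. An order unit at the exit point would let the
    line continue in C. *)
Lemma boundary_on_line e v : order_unit C e -> ~ C (- e) ->
  exists t, C (v + t *: e) /\ ~ order_unit C (v + t *: e).
Proof.
move=> ue nCe.
have [a a0 Ca] := ue v; have [b b0 Cb] := ue (- v).
have Cx : C (v + a^-1 *: e).
  have := coneZ convC C0 (ltW (divr_gt0 ltr01 a0)) Ca.
  by rewrite div1r scalerDr scalerA mulVf ?lt0r_neq0// scale1r addrC.
have Cy : ~ C (v - (b^-1 + 1) *: e).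
  move=> Cy; apply: nCe.
  have := coneD convC Cy (coneZ convC C0 (ltW (divr_gt0 ltr01 b0)) Cb).
  rewrite div1r scalerDr scalerA mulVf ?lt0r_neq0// scale1r.
  have -> // : v - (b^-1 + 1) *: e + (b^-1 *: e - v) = - e.
  by apply/rowP => i; rewrite !mxE; ring.
have [t [_ Ct exit]] := segment_exit convC closedC Cx Cy.
set d := _ - (v + _) in Ct exit.
have dE : d = - (b^-1 + 1 + a^-1) *: e.
  by rewrite /d; apply/rowP => i; rewrite !mxE; ring.
have tE : v + a^-1 *: e + t *: d = v + (a^-1 - t * (b^-1 + 1 + a^-1)) *: e.
  by rewrite dE; apply/rowP => i; rewrite !mxE; ring.
exists (a^-1 - t * (b^-1 + 1 + a^-1)); rewrite -tE; split=> // uo.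
have [s s0] := uo d; rewrite -addrA -scalerDl.
by apply: exit; rewrite ltrDl.
Qed.

(** Take boundary points v + t e and - v + s e, whose sum is (s + t) e. If s + t <= 0, pointedness
    makes the sum zero, then v + t e zero, and v is a multiple of e. *)
Lemma boundary_pair e v : order_unit C e -> (forall k, v <> k *: e) ->
  exists z1 z3, [/\ C z1, C z3, ~ order_unit C z1, ~ order_unit C z3 &
    order_unit C (z1 + z3)].
Proof.
move=> ue nv; have Ce := order_unit_mem ue.
have nCe : ~ C (- e).
  move=> /(salC Ce) e0; rewrite e0 in ue.
  have CT w : C w.
    have [s s0] := ue w; rewrite add0r => Cs.
    rewrite -(scale1r w) -(mulVf (lt0r_neq0 s0)) -scalerA.
    by apply: coneZ => //; rewrite invr_ge0 ltW.
  by apply: (nv 0); rewrite scale0r; apply: salC; exact: CT.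
have [t [Ct nt]] := boundary_on_line v ue nCe.
have [s [Cs ns]] := boundary_on_line (- v) ue nCe.
exists (- v + s *: e), (v + t *: e); split => //.
have E : - v + s *: e + (v + t *: e) = (s + t) *: e.
  by apply/rowP => i; rewrite !mxE; ring.
rewrite E; apply: order_unitZ => //; rewrite ltNge; apply/negP => st.
have Cst := coneD convC Cs Ct; rewrite E in Cst.
have Cst' : C (- ((s + t) *: e)).
  by rewrite -scaleNr; apply: coneZ => //; rewrite oppr_ge0.
have h := salC Cst Cst'; rewrite -E addrC in h.
have /eqP := h; rewrite addr_eq0 => /eqP h'.
have vt0 : v + t *: e = 0 by apply: salC => //; rewrite h' opprK.
by apply: (nv (- t)); move/eqP: vt0; rewrite addr_eq0 scaleNr => /eqP.
Qed.

Hypothesis IH : forall d, (d < n)%N -> forall C' : set 'rV[R]_d,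
  solid_cone C' -> simplicial C' \/ sandwich C'.

(** The face of z, read in a basis of its span, is a solid cone of smaller dimension because z is
    not interior. The projection along L' maps C onto this face, so a sandwich of the face is one of
    C. *)
Lemma factor_dichotomy z (L' : 'M[R]_n) : C z -> ~ order_unit C z ->
  (face_mx C z :&: L' = 0)%MS ->
  (forall c, C c -> exists a b,
    [/\ (a <= face_mx C z)%MS, (b <= L')%MS, c = a + b & C a]) ->
  (exists m (A : 'M[R]_(m, n)), [/\ row_free A, (A <= face_mx C z)%MS &
    forall a, (a <= face_mx C z)%MS ->
      C a <-> exists2 x : 'rV_m, (forall i, 0 <= x 0 i) & a = x *m A]) \/
  sandwich C.
Proof.
set L := face_mx C z => Cz nuz cap0 dec.
pose B := row_base L; pose d := \rank L.
have BL : (B <= L)%MS by rewrite eq_row_base.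
have LB : (L <= B)%MS by rewrite eq_row_base.
have fB : row_free B by exact: row_base_free.
pose C' : set 'rV[R]_d := [set x | C (x *m B)].
have dn : (d < n)%N.
  rewrite ltn_neqAle rank_leq_col andbT; apply/negP => /eqP dE.
  apply: nuz; apply/(order_unit_face convC C0 Cz).
  by rewrite /row_full -/L -/d dE.
have solid' : solid_cone C'.
  split.
  - by move=> x y s t Cx Cy s0 t0; rewrite /C' /= mulmxDl -!scalemxAl; exact: convC.
  - apply: (@preimage_closed _ _ (fun x : 'rV[R]_d => x *m B) C) => // x _.
    by apply: coord_cont_continuous; apply: coord_cont_mulmx; exact: coord_cont_id.
  - by rewrite /C' /= mul0mx.
  - move=> x Cx; rewrite /C' /= mulNmx => Cx'.
    by have := salC Cx Cx'; rewrite -(mul0mx _ B) => /(row_free_inj fB).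
  - exists (z *m pinvmx B) => v.
    have zB : z *m pinvmx B *m B = z.
      by apply: mulmxKpV; apply: submx_trans LB; exact: mem_face_mx.
    have /(face_mxP convC C0 _ Cz)[e e0 [h _]] : (v *m B <= L)%MS.
      by apply: submx_trans BL; exact: submxMl.
    by exists e => //; rewrite /C' /= mulmxDl zB -scalemxAl.
have [[m [A [fA AE]]]|sw] := IH dn solid'; [left|right].
  exists m, (A *m B); split.
  - by rewrite /row_free mxrankMfree.
  - by apply: submx_trans BL; exact: submxMl.
  - move=> a aL; have aB : a *m pinvmx B *m B = a.
      by apply: mulmxKpV; apply: submx_trans LB.
    split=> [Ca|[x x0 ->]].
      have /AE[x x0 xE] : C' (a *m pinvmx B) by rewrite /C' /= aB.
      by exists x => //; rewrite mulmxA -xE aB.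
    rewrite mulmxA; have : C' (x *m A) by apply/AE; exists x.
    by [].
apply: (@sandwich_retract _ _ _ _ B (proj_mx L L' *m pinvmx B)) sw => //.
- by rewrite mulmxA proj_mx_id// mulmxVp.
- move=> c /dec[a [b [aL bL' -> Ca]]]; rewrite /C' /=.
  have -> // : (a + b) *m (proj_mx L L' *m pinvmx B) *m B = a.
  rewrite [(a + b) *m _]mulmxA mulmxDl (proj_mx_id cap0 aL) (proj_mx_0 cap0 bL').
  by rewrite addr0; apply: mulmxKpV; apply: submx_trans LB.
Qed.

Lemma cone_dichotomy_step : (exists e, order_unit C e) -> simplicial C \/ sandwich C.
Proof.
move=> [e ue].
have [line|nline] := pselect (forall v, exists k, v = k *: e).
  by left; exact: simplicial_ray line.
have [v nv] : exists v, forall k, v <> k *: e.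
  apply: contrapT => nE; apply: nline => v; apply: contrapT => nk.
  by apply: nE; exists v => k vE; apply: nk; exists k.
pose adm z1 z3 := [/\ C z1, C z3, ~ order_unit C z1, ~ order_unit C z3 &
    order_unit C (z1 + z3)].
pose rk z := \rank (face_mx C z).
pose P k := `[< exists z1 z3, adm z1 z3 /\ (rk z1 + rk z3)%N = k >].
have exP : exists k, P k.
  have [z1 [z3 adm13]] := boundary_pair ue nv.
  by exists (rk z1 + rk z3)%N; apply/asboolP; exists z1, z3.
have [k /asboolP[z1 [z3 [[Cz1 Cz3 nz1 nz3 uz] kE]]] kmin] := ex_minnP exP.
have amin y1 y3 : adm y1 y3 -> (k <= rk y1 + rk y3)%N.
  by move=> adm13; apply: kmin; apply/asboolP; exists y1, y3.
(* The second point is perturbed with the first one fixed, then the first with the new second one.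
   Ranks are preserved, so the new pair is still minimal. *)
have [|y3 [f3 [[Cy3 ny3 uy3 rk3] [D3 f3y Z3]]]] :=
  exposed_face_near convC C0 closedC Cz1 Cz3 nz3 uz.
  move=> y Cy ny uy; have := amin z1 y (And5 Cz1 Cy nz1 ny uy).
  by rewrite -kE leq_add2l.
rewrite addrC in uy3.
have [|y1 [f1 [[Cy1 ny1 uy1 rk1] [D1 f1y Z1]]]] :=
  exposed_face_near convC C0 closedC Cy3 Cz1 nz1 uy3.
  move=> y Cy ny; rewrite addrC => uy; have := amin y y3 (And5 Cy Cy3 ny ny3 uy).
  by rewrite -kE /rk rk3 leq_add2r.
have uy13 : order_unit C (y1 + y3) by rewrite addrC.
have kE' : (rk y1 + rk y3)%N = k by rewrite /rk rk1 rk3.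
have dec a b : (a <= face_mx C y1)%MS -> (b <= face_mx C y3)%MS ->
    C (a + b) -> C a /\ C b.
  move=> aL bL Cab; split.
    apply: (minimal_pair_mem convC C0 closedC Cy3 Cy1 uy1 ny1 _ bL aL).
      move=> y Cy ny; rewrite addrC => uy; have := amin y y3 (And5 Cy Cy3 ny ny3 uy).
      by rewrite -kE' leq_add2r.
    by rewrite addrC.
  apply: (minimal_pair_mem convC C0 closedC Cy1 Cy3 uy13 ny3 _ aL bL Cab).
  move=> y Cy ny uy; have := amin y1 y (And5 Cy1 Cy ny1 ny uy).
  by rewrite -kE' leq_add2l.
(* For x in both spans, 0 = x + (- x) is a decomposition in C, so x and - x are in C. *)
have cap0 : (face_mx C y1 :&: face_mx C y3 = 0)%MS.
  apply/eqP; rewrite -submx0; apply/rV_subP => x; rewrite sub_capmx.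
  move=> /andP[x1 x3]; rewrite submx0.
  have x1' : (- x <= face_mx C y1)%MS by rewrite eqmx_opp.
  have x3' : (- x <= face_mx C y3)%MS by rewrite eqmx_opp.
  have [|Cx _] := dec x (- x) x1 x3'; first by rewrite subrr.
  have [|Cx' _] := dec (- x) x x1' x3; first by rewrite addNr.
  by apply/eqP; exact: salC.
have [fullN|nfullN] := boolP (row_full (face_mx C y1 + face_mx C y3)%MS); last first.
  right; apply: (sandwich_of_faces convC C0 closedC Cy1 Cy3 uy13 D1 D3) => //.
    by move=> c Cc; split; [exact: Z1 | exact: dual_face_eq0].
  by move=> c Cc; split; [exact: Z3 | exact: dual_face_eq0].
have split_cone c : C c -> exists a b,
    [/\ (a <= face_mx C y1)%MS, (b <= face_mx C y3)%MS, c = a + b, C a & C b].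
  move=> Cc; have /sub_addsmxP[[A B] /= cE] := submx_full c fullN.
  have [|Ca Cb] := dec _ _ (submxMl A (face_mx C y1)) (submxMl B (face_mx C y3)).
    by rewrite -cE.
  by exists (A *m face_mx C y1), (B *m face_mx C y3); split=> //; exact: submxMl.
have [[m1 [A1 [fA1 A1L A1E]]]|] := factor_dichotomy Cy1 ny1 cap0
  (fun c Cc => let: ex_intro a (ex_intro b (And5 h1 h2 h3 h4 _)) := split_cone c Cc in
    ex_intro _ a (ex_intro _ b (And4 h1 h2 h3 h4))); last by right.
rewrite capmxC in cap0.
have [[m3 [A3 [fA3 A3L A3E]]]|] := factor_dichotomy Cy3 ny3 cap0
  (fun c Cc => let: ex_intro a (ex_intro b (And5 h1 h2 h3 _ h5)) := split_cone c Cc in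
    ex_intro _ b (ex_intro _ a (And4 h2 h1 (etrans h3 (addrC a b)) h5))); last by right.
left; exists (m1 + m3)%N, (col_mx A1 A3); split.
  rewrite -kermx_eq0 -submx0; apply/rV_subP => x; rewrite sub_kermx submx0.
  rewrite -(hsubmxK x) mul_row_col addr_eq0 => /eqP xE.
  have h1 : (lsubmx x *m A1 <= face_mx C y1)%MS by apply: submx_trans A1L; exact: submxMl.
  have h3 : (lsubmx x *m A1 <= face_mx C y3)%MS.
    by rewrite xE eqmx_opp; apply: submx_trans A3L; exact: submxMl.
  have h0 : lsubmx x *m A1 = 0.
    by apply/eqP; rewrite -submx0 -cap0 sub_capmx h3 h1.
  have l0 : lsubmx x = 0 by apply: (row_free_inj fA1); rewrite mul0mx.
  have r0 : rsubmx x = 0.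
    apply: (row_free_inj fA3); rewrite mul0mx; apply/eqP.
    by rewrite -oppr_eq0 -xE h0.
  by rewrite l0 r0 row_mx0.
move=> c; split=> [/split_cone[a [b [aL bL -> Ca Cb]]]|[x x0 ->]].
  have /(A1E a aL)[x1 x10 ->] := Ca; have /(A3E b bL)[x3 x30 ->] := Cb.
  exists (row_mx x1 x3); last by rewrite mul_row_col.
  by move=> i; rewrite mxE; case: splitP => j _.
rewrite -(hsubmxK x) mul_row_col; apply: coneD => //.
  apply/A1E; first by apply: submx_trans A1L; exact: submxMl.
  by exists (lsubmx x) => // i; rewrite mxE.
apply/A3E; first by apply: submx_trans A3L; exact: submxMl.
by exists (rsubmx x) => // i; rewrite mxE.
Qed.

End Step.

Lemma cone_dichotomy n (C : set 'rV[R]_n) :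
  solid_cone C -> simplicial C \/ sandwich C.
Proof.
elim/ltn_ind: n C => n IH C [convC closedC C0 salC exC].
by apply: cone_dichotomy_step => // d dn C' solid'; exact: IH.
Qed.

End Dichotomy.
Import VectorInternalTheory.

(** * Kites and squares *)

Section Transfer.
Context {R : realType} {V : vectType R}.
Variable C : set V.
Let n := dim V.
Let C' : set 'rV[R]_n := @r2v R V @^-1` C.

(** Write each basis vector as p_i - q_i with both terms in C. The sum of all p_i + q_i is an order
    unit: adding a vector with coordinates t_i of absolute value at most 1 changes the coefficients
    to 1 + t_i and 1 - t_i. *)
Lemma proper_solid : proper_cone C -> solid_cone C'.
Proof.
move=> [convC closedC capC genC].
have C0 : C 0.
  have : [set 0 : V] 0 by [].
  by rewrite -capC => -[].
have convC' : convex_cone C'.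
  by move=> x y s t Cx Cy s0 t0; rewrite /C' /= linearD !linearZ; exact: convC.
have C'0 : C' 0 by rewrite /C' /= linear0.
split=> //.
  move=> x Cx; rewrite /C' /= linearN => Cx'.
  have : (C `&` [set - y | y in C]) (@r2v R V x).
    by split=> //; exists (- (@r2v R V x)) => //; rewrite opprK.
  by rewrite capC /= => x0; apply: (@r2v_inj R V); rewrite linear0.
have dec (i : 'I_n) : {p : 'rV[R]_n * 'rV[R]_n |
    [/\ C' p.1, C' p.2 & delta_mx 0 i = p.1 - p.2]}.
  apply: cid.
  have : [set x - y | x in C & y in C] (@r2v R V (delta_mx 0 i)) by rewrite genC.
  move=> [x Cx [y Cy xy]]; exists (v2r x, v2r y); rewrite /C' /= !v2rK; split => //.
  by apply: (@r2v_inj R V); rewrite linearB /= !v2rK.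
pose p i := (sval (dec i)).1; pose q i := (sval (dec i)).2.
have Cp i : C' (p i) by rewrite /p; case: (dec i) => ? [].
have Cq i : C' (q i) by rewrite /q; case: (dec i) => ? [].
have pq i : delta_mx 0 i = p i - q i by rewrite /p /q; case: (dec i) => ? [].
exists (\sum_i (p i + q i)) => v.
have v0 : 0 < `|v| + 1 by rewrite ltr_wpDl.
exists (`|v| + 1)^-1; first by rewrite invr_gt0.
have -> : \sum_i (p i + q i) + (`|v| + 1)^-1 *: v =
    \sum_i ((1 + (`|v| + 1)^-1 * v 0 i) *: p i + (1 - (`|v| + 1)^-1 * v 0 i) *: q i).
  rewrite {2}(row_sum_delta v) scaler_sumr -big_split; apply: eq_bigr => i _ /=.
  rewrite pq scalerA scalerBr !scalerDl scaleNr !scale1r.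
  by rewrite addrACA.
have bnd i : `|(`|v| + 1)^-1 * v 0 i| <= 1.
  rewrite normrM normfV (ger0_norm (ltW v0)) [leLHS]mulrC ler_pdivrMr// mul1r.
  by rewrite (le_trans (coord_le_norm v i))// lerDl.
by apply: (cone_sum convC' C'0) => i; have := bnd i; rewrite ler_norml => /andP[? ?];
  apply: convC' => //; lra.
Qed.

Lemma simplicial_classical : proper_cone C -> simplicial C' -> classical C.
Proof.
move=> [convC closedC capC genC] [m [B [fB CB]]].
pose X : m.-tuple V := [tuple @r2v R V (row i B) | i < m].
have Xi (i : 'I_m) : X`_i = @r2v R V (row i B).
  by rewrite -tnth_nth tnth_mktuple.
have XE (x : 'rV[R]_m) : @r2v R V (x *m B) = \sum_i x 0 i *: X`_i.
  rewrite mulmx_sum_row linear_sum; apply: eq_bigr => i _.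
  by rewrite linearZ Xi.
have CX c : C c -> exists2 x : 'rV[R]_m, (forall i, 0 <= x 0 i) & c = \sum_i x 0 i *: X`_i.
  move=> Cc; have /CB[x x0 xE] : C' (v2r c) by rewrite /C' /= v2rK.
  by exists x => //; rewrite -XE -xE v2rK.
have XC (x : 'rV[R]_m) : (forall i, 0 <= x 0 i) -> C (\sum_i x 0 i *: X`_i).
  by move=> x0; rewrite -XE; apply/CB; exists x.
exists X; split.
  rewrite /basis_of; apply/andP; split.
    rewrite eqEsubv subvf/=; apply/subvP => v _.
    have : [set x - y | x in C & y in C] v by rewrite genC.
    move=> [x /CX[a _ ->] [y /CX[b _ ->] <-]].
    have mem (c : 'rV[R]_m) : \sum_i c 0 i *: X`_i \in <<X>>%VS.
      by apply: memv_suml => i _; apply/memvZ/memv_span/mem_nth; rewrite size_tuple.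
    by rewrite rpredB.
  apply/freeP => k k0 i.
  have : (\row_i k i) *m B = 0.
    apply: (@r2v_inj R V); rewrite XE linear0 -[RHS]k0.
    by apply: eq_bigr => j _; rewrite mxE.
  rewrite -(mul0mx _ B) => /(row_free_inj fB) /rowP /(_ i).
  by rewrite !mxE.
rewrite predeqE => c; split=> [/CX[x x0 ->] D [[convD D0] XD]|].
  elim/big_ind : _ => // [u v Du Dv|i _].
    by have := convD u v 1 1 Du Dv ler01 ler01; rewrite !scale1r.
  have DX : D X`_i.
    have XiX : X`_i \in X by rewrite mem_nth ?size_tuple.
    exact: XD.
  by have := convD _ _ _ _ DX D0 (x0 i) (lexx 0); rewrite scaler0 addr0.
apply; split.
  split=> //; have : [set 0 : V] 0 by [].
  by rewrite -capC => -[].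
move=> _ /tnthP[j ->]; rewrite (tnth_nth 0).
have := XC (delta_mx 0 j); rewrite (bigD1 j)//= big1.
  rewrite mxE !eqxx scale1r addr0; apply.
  by move=> i; rewrite mxE; case: (_ && _).
by move=> i ij; rewrite mxE (negbTE ij) andbF scale0r.
Qed.

Section KiteMaps.
Variables (gx gy gt : 'rV[R]_n) (vx vy vt : V).

Let toKite (v : V) : 'rV[R]_2 * R^o :=
  (pt (dot gx (v2r v)) (dot gy (v2r v)), dot gt (v2r v)).

Fact toKite_linear : linear toKite.
Proof.
move=> a u v; rewrite /toKite; congr pair; last first.
  by rewrite linearD linearZ /= dotDr dotZr.
apply/rowP => i; rewrite !mxE; case: i => -[|[|//]] ? /=;
  by rewrite linearD linearZ /= dotDr dotZr.
Qed.
HB.instance Definition _ := GRing.isLinear.Build R V _ _ toKite toKite_linear.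

Definition kite_proj : 'Hom(V, ('rV[R]_2 * R^o)%type) := linfun toKite.

Lemma kite_projE v : kite_proj v =
  (pt (dot gx (v2r v)) (dot gy (v2r v)), dot gt (v2r v)).
Proof. by rewrite lfunE. Qed.

Let ofKite (p : 'rV[R]_2 * R^o) : V :=
  p.1 0 0 *: vx + p.1 0 1 *: vy + p.2 *: vt.

Fact ofKite_linear : linear ofKite.
Proof.
move=> a u v; rewrite /ofKite /= !mxE !scalerDl !scalerDr !scalerA.
by rewrite [RHS]addrACA; congr (_ + _); rewrite addrACA.
Qed.
HB.instance Definition _ := GRing.isLinear.Build R _ V _ ofKite ofKite_linear.

Definition kite_lift : 'Hom(('rV[R]_2 * R^o)%type, V) := linfun ofKite.

Lemma kite_liftE p : kite_lift p = p.1 0 0 *: vx + p.1 0 1 *: vy + p.2 *: vt.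
Proof. by rewrite lfunE. Qed.

End KiteMaps.
End Transfer.
Local Open Scope convex_scope.

(** * From functionals to sandwichings, and the obstruction for classical cones *)

Section KiteSquare.
Context {R : realType} {V : vectType R}.
Variable C : set V.
Let n := dim V.
Let C' : set 'rV[R]_n := @r2v R V @^-1` C.

Lemma ptE0 (x y : R) : pt x y 0 0 = x. Proof. by rewrite mxE. Qed.
Lemma ptE1 (x y : R) : pt x y 0 1 = y. Proof. by rewrite mxE. Qed.

Lemma pt_eta (p : 'rV[R]_2) : p = pt (p 0 0) (p 0 1).
Proof.
apply/rowP => i; rewrite !mxE; case: i => -[|[|//]] ? /=;
  by congr (p 0 _); apply: val_inj.
Qed.

Lemma scale_pt a (x y : R) : a *: pt x y = pt (a * x) (a * y).
Proof. by apply/rowP => i; rewrite !mxE; case: i => -[|[|//]] ?. Qed.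

Lemma hom_comb (U W : vectType R) (F : 'Hom(U, W)) a b x y :
  F (a *: x + b *: y) = a *: F x + b *: F y.
Proof. by rewrite linearD !linearZ. Qed.

Lemma kite_vertex_bound (g h u : R) : 0 < g -> 0 < h -> g + h = u ->
  -1 < (h - g) / u < 1.
Proof.
move=> g0 h0 uE; have u0 : 0 < u by lra.
by rewrite ltr_pdivlMr// ltr_pdivrMr//; apply/andP; split; lra.
Qed.

(* Two of [x], [y], [t] have the same sign unless all vanish. *)
Lemma sandwich_independent (x y t g12 g13 g21 g23 g31 g32 g41 g42 g43 : R) :
  0 < g12 -> 0 < g13 -> 0 < g21 -> 0 < g23 -> 0 < g31 -> 0 < g32 ->
  g21 + g41 = g31 -> g42 = g12 + g32 -> g23 + g43 = g13 ->
  x * g31 + y * g32 - (y * g12 + t * g13) = 0 ->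
  x * g41 + y * g42 + t * g43 - (x * g21 + t * g23) = 0 ->
  y * g12 + t * g13 + (x * g31 + y * g32) = 0 ->
  [/\ x = 0, y = 0 & t = 0].
Proof.
move=> p12 p13 p21 p23 p31 p32 e1 e2 e3 h1 h2 h3.
have k1 : y * g12 + t * g13 = 0 by lra.
have k3 : x * g31 + y * g32 = 0 by lra.
have k2 : x * g21 + t * g23 = 0 by rewrite -e1 e2 -e3 in h1 h2 h3 k1 k3; lra.
have y0 : y = 0.
  have [yn|yp|//] := ltgtP y 0; exfalso.
    have x0 : 0 < x by rewrite ltNge; apply/negP => x0; nra.
    have t0 : 0 < t by rewrite ltNge; apply/negP => t0; nra.
    have := mulr_gt0 x0 p21; have := mulr_gt0 t0 p23; lra.
  have x0 : 0 < - x by rewrite ltNge; apply/negP => x0; nra.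
  have t0 : 0 < - t by rewrite ltNge; apply/negP => t0; nra.
  have := mulr_gt0 x0 p21; have := mulr_gt0 t0 p23; lra.
move: k1 k3; rewrite y0 !mul0r add0r addr0 => /eqP + /eqP.
by rewrite !mulf_eq0 !(gt_eqF p13) !(gt_eqF p31) !orbF => /eqP -> /eqP ->.
Qed.

(** Phi has the coordinates x = g3 - g1, y = g4 - g2, t = g1 + g3, so the sides of the square are
    the zeros of the g_i. Psi is the section of Phi with image the span of v1, v2, v3; it contains
    v4 because v1 + v3 = v2 + v4. *)
Lemma sandwich_kite : convex_cone C -> C 0 -> sandwich C' ->
  kite_square_sandwiching C.
Proof.
move=> convC C0 [g1 [g2 [g3 [g4 [v1 [v2 [v3 [v4 []]]]]]]]].
move=> [D1 D2 D3 D4] [C1 C2 C3 C4] [gE vE] [z1 z2 z3 z4] [bl [p1 p2 p3 p4]].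
have U13 x : dot g1 x + dot g3 x = dot (g1 + g3) x by rewrite dotDl.
have U24 x : dot g2 x + dot g4 x = dot (g1 + g3) x by rewrite gE dotDl.
have pos g x : dual_cone C' g -> C' x -> 0 < dot (g1 + g3) x ->
    (dot g x = 0 -> dot (g1 + g3) x = 0) -> 0 < dot g x.
  move=> Dg Cx Ux gx; rewrite lt_neqAle Dg// andbT; apply/eqP => /esym/gx h.
  by rewrite h ltxx in Ux.
have g31 : dot g3 v1 = dot (g1 + g3) v1 by rewrite -U13 z1 add0r.
have g13 : dot g1 v3 = dot (g1 + g3) v3 by rewrite -U13 z3 addr0.
have g42 : dot g4 v2 = dot (g1 + g3) v2 by rewrite -U24 z2 add0r.
have g24 : dot g2 v4 = dot (g1 + g3) v4 by rewrite -U24 z4 addr0.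
(* Each v_i already lies on one side; were it on an adjacent one too, g1 + g3 would vanish at it. So
   the vertices of the kite avoid the corners. *)
have g21 : 0 < dot g2 v1 by apply: pos => // h; apply: bl; [|left|left].
have g41 : 0 < dot g4 v1 by apply: pos => // h; apply: bl; [|left|right].
have g23 : 0 < dot g2 v3 by apply: pos => // h; apply: bl; [|right|left].
have g43 : 0 < dot g4 v3 by apply: pos => // h; apply: bl; [|right|right].
have g12 : 0 < dot g1 v2 by apply: pos => // h; apply: bl; [|left|left].
have g32 : 0 < dot g3 v2 by apply: pos => // h; apply: bl; [|right|left].
have g14 : 0 < dot g1 v4 by apply: pos => // h; apply: bl; [|left|right].
have g34 : 0 < dot g3 v4 by apply: pos => // h; apply: bl; [|right|right].
pose a x := (dot g3 x - dot g1 x) / dot (g1 + g3) x.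
pose b x := (dot g4 x - dot g2 x) / dot (g1 + g3) x.
exists (b v1), (a v2), (b v3), (a v4); split.
  by split; apply: kite_vertex_bound.
pose Phi := kite_proj (V := V) (g3 - g1) (g4 - g2) (g1 + g3).
pose J := kite_lift (R := R) (@r2v R V v1) (@r2v R V v2) (@r2v R V v3).
have PhiE x : Phi (@r2v R V x) =
    (pt (dot g3 x - dot g1 x) (dot g4 x - dot g2 x), dot (g1 + g3) x).
  by rewrite kite_projE r2vK !dotBl.
(* The images of v1, v2, v3 under Phi are linearly independent, so Phi can be inverted on their
   span. *)
have kerG : lker (Phi \o J)%VF == 0%VS.
  apply/lker0P => p q; rewrite !comp_lfunE => /eqP.
  rewrite -subr_eq0 -!linearB /= => /eqP pq.
  apply/eqP; rewrite -subr_eq0; apply/eqP.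
  move: (p - q) pq => [w t]; rewrite (pt_eta w); move: (w 0 0) (w 0 1) => x y.
  rewrite kite_liftE /= ptE0 ptE1 -!linearZ -!linearD PhiE.
  case=> /rowP h; have := h 0; have := h 1; rewrite !mxE /= => {h}.
  rewrite -U13 !dotE z1 z2 z3 !mulr0 !addr0 !add0r => h1 h2 h3.
  have := U24 v1; have := U24 v2; have := U24 v3.
  rewrite -!U13 z1 z2 z3 !addr0 !add0r => e3 e2 e1.
  have [-> -> ->] : [/\ x = 0, y = 0 & (t : R) = 0].
    apply: (sandwich_independent g12 _ g21 g23 _ g32 e1 e2 e3 h2 h1 h3).
      by rewrite g13.
    by rewrite g31.
  by congr pair; apply/rowP => i; rewrite !mxE; case: i => -[|[|//]] ?.
pose Psi := (J \o (Phi \o J)^-1)%VF.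
have PP : (Phi \o Psi)%VF = \1%VF by rewrite /Psi comp_lfunA lker0_compfV.
have PsiJ p : Psi (Phi (J p)) = J p.
  by have := lker0_lfunK kerG p; rewrite /Psi !comp_lfunE => ->.
clearbody Psi.
have Psi1 : Psi (Phi (@r2v R V v1)) = @r2v R V v1.
  have <- : J (pt 1 0, 0) = @r2v R V v1.
    by rewrite kite_liftE /= ptE0 ptE1 scale1r !scale0r !addr0.
  exact: PsiJ.
have Psi2 : Psi (Phi (@r2v R V v2)) = @r2v R V v2.
  have <- : J (pt 0 1, 0) = @r2v R V v2.
    by rewrite kite_liftE /= ptE0 ptE1 scale1r !scale0r add0r addr0.
  exact: PsiJ.
have Psi3 : Psi (Phi (@r2v R V v3)) = @r2v R V v3.
  have <- : J (pt 0 0, 1) = @r2v R V v3.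
    by rewrite kite_liftE /= ptE0 ptE1 scale1r !scale0r !add0r.
  exact: PsiJ.
have Psi4 : Psi (Phi (@r2v R V v4)) = @r2v R V v4.
  have -> : @r2v R V v4 =
      1 *: (1 *: @r2v R V v1 + 1 *: @r2v R V v3) + (-1) *: @r2v R V v2.
    by rewrite !scale1r scaleN1r -linearD -linearB vE [v2 + v4]addrC addrK.
  by rewrite !(hom_comb Phi) !(hom_comb Psi) Psi1 Psi2 Psi3.
exists Psi, Phi; split=> // [_ [[w t] [/= t0 [x Kx xw]] <-]|_ [v Cv <-]].
  (* It is enough that this convex set contains the four vertices; Psi sends each of them to a
     positive multiple of the corresponding v_i. *)
  pose D := [set x : 'rV[R]_2 | C (Psi (x, 1))].
  have convD : @convex_set R 'rV[R]_2 D.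
    move=> y z l; rewrite !inE /D /= => Dy Dz.
    have -> : ((y <| l |> z : 'rV[R]_2), (1 : R^o)) =
        l%:num *: ((y : 'rV[R]_2), (1 : R^o)) + (1 - l%:num) *: ((z : 'rV[R]_2), (1 : R^o)).
      congr pair; rewrite /=.
      by rewrite -[RHS]/(l%:num * 1 + (1 - l%:num) * 1); ring.
    have l0 : (0 : R) <= l%:num by exact: ge0.
    have l1 : l%:num <= (1 : R) by exact: le1.
    by rewrite (hom_comb Psi); apply: convC; rewrite ?subr_ge0.
  have vertex y w' : C' y -> 0 < dot (g1 + g3) y -> Psi (Phi (@r2v R V y)) = @r2v R V y ->
      w' = pt (a y) (b y) -> D w'.
    move=> Cy Uy Py ->; rewrite /D /=.
    have -> : (pt (a y) (b y), 1 : R^o) = (dot (g1 + g3) y)^-1 *: Phi (@r2v R V y).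
      rewrite PhiE; congr pair; rewrite /=; last first.
        by rewrite -[RHS]/((dot (g1 + g3) y)^-1 * dot (g1 + g3) y) mulVf// lt0r_neq0.
      by rewrite scale_pt /a /b mulrC (mulrC (dot g4 y - _)).
    rewrite linearZ /= Py -(addr0 (_ *: _)) -(scaler0 _ (0 : R)); apply: convC => //.
    by rewrite invr_ge0 ltW.
  have Dx : D x.
    apply: Kx; split=> // y /= [[[]|]|] ->.
    - by apply: (vertex v1) => //; rewrite /a z1 g31 subr0 divff// lt0r_neq0.
    - by apply: (vertex v2) => //; rewrite /b z2 g42 subr0 divff// lt0r_neq0.
    - by apply: (vertex v3) => //; rewrite /a z3 g13 sub0r mulNr divff// lt0r_neq0.
    - by apply: (vertex v4) => //; rewrite /b z4 g24 sub0r mulNr divff// lt0r_neq0.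
  have -> : (w, t) = t *: (x, 1 : R^o).
    by rewrite -xw; congr pair; rewrite /= -[RHS]/(t * 1) mulr1.
  rewrite linearZ /= -(addr0 (_ *: _)) -(scaler0 _ (0 : R)); exact: convC.
have Cv' : C' (v2r v) by rewrite /C' /= v2rK.
rewrite -(v2rK v) PhiE; set x := v2r v in Cv' *.
have h1 := D1 x Cv'; have h2 := D2 x Cv'; have h3 := D3 x Cv'; have h4 := D4 x Cv'.
have e13 := U13 x; have e24 := U24 x.
split=> /=; first by lra.
have [U0|U0] := eqVneq (dot (g1 + g3) x) 0.
  (* At height 0 the image is the apex, which is 0 times any point of the blunt square. *)
  exists (pt 0 0).
    split; first by move=> i; rewrite mxE; case: i => -[|[|//]] ? /=;
      rewrite lerN10 ler01.
    by move/(_ 0); rewrite ptE0 => -[] /esym/eqP; rewrite ?oppr_eq0 oner_eq0.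
  have -> : dot g3 x - dot g1 x = 0 by lra.
  have -> : dot g4 x - dot g2 x = 0 by lra.
  by rewrite scale_pt !mulr0.
have Up : 0 < dot (g1 + g3) x by rewrite lt_neqAle eq_sym U0/=; lra.
exists (pt (a x) (b x)); last first.
  by rewrite scale_pt /a /b !(mulrC (dot (g1 + g3) x)) !divfK.
have aE : a x * dot (g1 + g3) x = dot g3 x - dot g1 x by rewrite divfK.
have bE : b x * dot (g1 + g3) x = dot g4 x - dot g2 x by rewrite divfK.
split.
  move=> i; rewrite mxE; case: i => -[|[|//]] ? /=;
    by rewrite ler_pdivlMr// ler_pdivrMr//; apply/andP; split; lra.
move=> h; have := h 0; have := h 1; rewrite ptE0 ptE1 => hb ha.
have : dot (g1 + g3) x = 0.
  apply: bl => //.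
    by case: ha => ha; rewrite ha in aE; [right|left]; lra.
  by case: hb => hb; rewrite hb in bE; [right|left]; lra.
by move/eqP; rewrite (negbTE U0).
Qed.

(* [s] and [r] locate the crossing point of the diagonals of the kite on each of
   them. *)
Lemma kite_diagonals (a1 a2 a3 a4 : R) :
  -1 < a1 < 1 -> -1 < a2 < 1 -> -1 < a3 < 1 -> -1 < a4 < 1 ->
  exists s r : R, [/\ -1 < s < 1, -1 <= r <= 1,
    2 * s = (1 + r) * a2 + (1 - r) * a4 & 2 * r = (1 + s) * a1 + (1 - s) * a3].
Proof.
move=> /andP[l1 u1] /andP[l2 u2] /andP[l3 u3] /andP[l4 u4].
pose den := 2 - (a1 - a3) * (a2 - a4) / 2.
pose num := (a2 + a4) + (a1 + a3) * (a2 - a4) / 2.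
have h1 : 0 < den - num.
  have -> : den - num = (1 - a2) * (1 + a1) + (1 - a4) * (1 - a1).
    by rewrite /den /num; field.
  by rewrite addr_gt0// mulr_gt0//; lra.
have h2 : 0 < den + num.
  have -> : den + num = (1 + a2) * (1 + a3) + (1 + a4) * (1 - a3).
    by rewrite /den /num; field.
  by rewrite addr_gt0// mulr_gt0//; lra.
have d0 : 0 < den by lra.
have sE : num / den * den = num by rewrite divfK// lt0r_neq0.
exists (num / den), (((1 + num / den) * a1 + (1 - num / den) * a3) / 2).
move: sE; have : -1 < num / den < 1.
  by rewrite ltr_pdivlMr// ltr_pdivrMr//; apply/andP; split; lra.
move: (num / den) => s /andP[s1 s2] sE; split.
- by rewrite s1.
- by apply/andP; split; nra.
- by rewrite /den /num in sE; nra.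
- by field.
Qed.

Lemma kite_not_classical : kite_square_sandwiching C -> ~ classical C.
Proof.
move=> [a1 [a2 [a3 [a4 [[b1 b2 b3 b4] [Psi [Phi [PP PsiC PhiC]]]]]]]] [A [basA CE]].
pose X := in_tuple A.
have spanX v : v = \sum_i coord X i v *: X`_i.
  apply: coord_span; have /andP[/eqP -> _] := basA; exact: memvf.
have freeX : free X by have /andP[] := basA.
have coord0 c i : C c -> 0 <= coord X i c.
  rewrite CE => /(_ [set c | forall i, 0 <= coord X i c]); apply; split.
    split=> [x y s t hx hy s0 t0 j|j]; last by rewrite linear0.
    by rewrite linearD !linearZ /= addr_ge0// mulr_ge0.
  move=> x /= xA j; have [k kA <-] := nthP 0 xA.
  by rewrite (coord_free (Ordinal kA) j freeX) ler0n.
have CX (i : 'I_(size A)) : C X`_i.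
  have XiA : X`_i \in A by apply: mem_nth; exact: ltn_ord.
  by rewrite CE => D [_ AD]; exact: AD.
(* For s = 1 or s = -1, these are the four functionals of the sides of the square, composed with
   Phi. *)
pose f (s : R) (j : 'I_2) (v : V) : R := (Phi v).2 + s * (Phi v).1 0 j.
have f_lin s j : linear (f s j : V -> R^o).
  move=> k u v; rewrite /f linearD linearZ /= !mxE.
  move: (Phi u).2 (Phi v).2 ((Phi u).1 0 j) ((Phi v).1 0 j) => x y x' y'.
  by rewrite -[LHS]/(k * (x : R) + (y : R) + s * (k * x' + y'))
             -[RHS]/(k * ((x : R) + s * x') + ((y : R) + s * y')); ring.
have fX s j v : f s j v = \sum_i coord X i v * f s j X`_i.
  pose F : {linear V -> R^o} := HB.pack (f s j)
    (GRing.isLinear.Build R V R^o _ (f s j) (f_lin s j)).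
  by rewrite {1}(spanX v) -[LHS]/(F _) linear_sum; apply: eq_bigr => i _; rewrite linearZ.
have PhiP v : C v -> [/\ 0 <= ((Phi v).2 : R),
    forall j, - ((Phi v).2 : R) <= (Phi v).1 0 j <= (Phi v).2 &
    forall s t, s = 1 \/ s = -1 -> t = 1 \/ t = -1 ->
      f s 0 v = 0 -> f t 1 v = 0 -> Phi v = 0].
  move=> Cv; have [t0 [x [xsq xcor] xE]] : cone_over blunt_square (Phi v).
    by apply: PhiC; exists v.
  move: t0 xE; rewrite /f; case: (Phi v) => w t /= t0 <-.
  have tR : 0 <= (t : R) by [].
  split=> // [j|s r sE rE].
    have /andP[x1 x2] := xsq j; rewrite mxE.
    by apply/andP; split; move: tR x1 x2; move: (x 0 j) (t : R) => y t'; nra.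
  rewrite !mxE => f0 f1; have [t1|t1] := eqVneq (t : R) 0.
    by rewrite t1 scale0r.
  exfalso; apply: xcor => i.
  have key (s' : R) (y : R) : s' = 1 \/ s' = -1 -> (t : R) + s' * ((t : R) * y) = 0 ->
      y = -1 \/ y = 1.
    move=> s'E; have -> : (t : R) + s' * ((t : R) * y) = (t : R) * (1 + s' * y) by ring.
    move/eqP; rewrite mulf_eq0 (negbTE t1)/= => /eqP.
    by case: s'E => ->; rewrite ?mul1r ?mulN1r => h; [left|right]; lra.
  case: i => -[|[|//]] i2.
    have -> : Ordinal i2 = 0 by apply: val_inj.
    exact: key sE f0.
  have -> : Ordinal i2 = 1 by apply: val_inj.
  exact: key rE f1.
have vert (x y : R) : kite a1 a2 a3 a4 (pt x y) -> C (Psi (pt x y, 1)) /\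
    Phi (Psi (pt x y, 1)) = (pt x y, 1).
  move=> K; split.
    apply: PsiC; exists (pt x y, 1) => //; split=> /=; first exact: ler01.
    by exists (pt x y); rewrite ?scale1r.
  by rewrite -comp_lfunE PP id_lfunE.
have sub p : [set pt 1 a1; pt a2 1; pt (-1) a3; pt a4 (-1)] p -> kite a1 a2 a3 a4 p.
  by move=> pK D [_]; apply.
have [Cw1 Pw1] := vert _ _ (sub (pt 1 a1) (or_introl (or_introl (or_introl erefl)))).
have [Cw2 Pw2] := vert _ _ (sub (pt a2 1) (or_introl (or_introl (or_intror erefl)))).
have [Cw3 Pw3] := vert _ _ (sub (pt (-1) a3) (or_introl (or_intror erefl))).
have [Cw4 Pw4] := vert _ _ (sub (pt a4 (-1)) (or_intror erefl)).
set w1 := Psi _ in Cw1 Pw1; set w2 := Psi _ in Cw2 Pw2.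
set w3 := Psi _ in Cw3 Pw3; set w4 := Psi _ in Cw4 Pw4.
have [s [r [/andP[s1 s2] /andP[r1 r2] sE rE]]] := kite_diagonals b1 b2 b3 b4.
have wE : (1 + s) *: w1 + (1 - s) *: w3 = (1 + r) *: w2 + (1 - r) *: w4.
  rewrite -!linearZ -!linearD; congr (Psi _).
  congr pair => /=; last first.
    by rewrite -[LHS]/((1 + s) * 1 + (1 - s) * 1) -[RHS]/((1 + r) * 1 + (1 - r) * 1); ring.
  by apply/rowP => i; rewrite !mxE; case: i => -[|[|//]] ? /=; lra.
have fge s' j (i : 'I_(size A)) : s' = 1 \/ s' = -1 -> 0 <= f s' j X`_i.
  move=> s'E; have [_ /(_ j) /andP[h1 h2] _] := PhiP _ (CX i).
  rewrite /f; case: s'E => ->; move: h1 h2;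
    move: ((Phi X`_i).1 0 j) ((Phi X`_i).2 : R) => y t h1 h2; lra.
(* The value at w is a sum of nonnegative terms over the basis, so every term vanishes. *)
have zero s' j w : s' = 1 \/ s' = -1 -> C w -> f s' j w = 0 ->
    forall i, coord X i w * f s' j X`_i = 0.
  move=> s'E Cw; rewrite fX => /eqP.
  rewrite psumr_eq0 => [/allP h i|i _]; last by rewrite mulr_ge0 ?coord0 ?fge.
  by have /eqP := h i (mem_index_enum i).
have z1 := zero (-1) 0 w1 (or_intror erefl) Cw1.
have z2 := zero (-1) 1 w2 (or_intror erefl) Cw2.
have z4 := zero 1 1 w4 (or_introl erefl) Cw4.
have {}z1 : forall i, coord X i w1 * f (-1) 0 X`_i = 0.
  by apply: z1; rewrite /f Pw1 /= ptE0 mulr1; exact: subrr.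
have {}z2 : forall i, coord X i w2 * f (-1) 1 X`_i = 0.
  by apply: z2; rewrite /f Pw2 /= ptE1 mulr1; exact: subrr.
have {}z4 : forall i, coord X i w4 * f 1 1 X`_i = 0.
  by apply: z4; rewrite /f Pw4 /= ptE1 mulrN1; exact: subrr.
(* A basis vector occurring in w1 has a positive coefficient on the left of [wE], as s > -1, hence
   occurs in w2 or w4. It is thus sent to two adjacent sides, that is, to 0; this makes Phi w1 zero,
   although its height is 1. *)
have PhiX i : coord X i w1 *: Phi X`_i = 0.
  have [->|x1] := eqVneq (coord X i w1) 0; first by rewrite scale0r.
  have x1p : 0 < coord X i w1 by rewrite lt_neqAle eq_sym x1 coord0.
  have f1 : f (-1) 0 X`_i = 0.
    by have /eqP := z1 i; rewrite mulf_eq0 (negbTE x1) => /eqP.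
  have cE : (1 + s) * coord X i w1 + (1 - s) * coord X i w3 =
      (1 + r) * coord X i w2 + (1 - r) * coord X i w4.
    by have := congr1 (coord X i) wE; rewrite !linearD !linearZ.
  have [_ _ blunt] := PhiP _ (CX i).
  have c3 := coord0 _ i Cw3.
  have [x2|x2] := eqVneq (coord X i w2) 0; last first.
    have f2 : f (-1) 1 X`_i = 0.
      by have /eqP := z2 i; rewrite mulf_eq0 (negbTE x2) => /eqP.
    by rewrite (blunt (-1) (-1)) ?scaler0//; right.
  have [x4|x4] := eqVneq (coord X i w4) 0; last first.
    have f4 : f 1 1 X`_i = 0.
      by have /eqP := z4 i; rewrite mulf_eq0 (negbTE x4) => /eqP.
    by rewrite (blunt (-1) 1) ?scaler0//; [right | left].
  exfalso; have p1 : 0 < (1 + s) * coord X i w1 by rewrite mulr_gt0//; lra.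
  have p3 : 0 <= (1 - s) * coord X i w3 by rewrite mulr_ge0//; lra.
  move: cE; rewrite x2 x4 !mulr0 addr0 => /eqP.
  by rewrite gt_eqF// ltr_pwDl.
have : Phi w1 = 0.
  rewrite (spanX w1) linear_sum big1// => i _; rewrite linearZ; exact: PhiX.
rewrite Pw1 => -[_ /eqP]; by rewrite oner_eq0.
Qed.

End KiteSquare.

Theorem theorem2 (R : realType) (V : vectType R) (C : set V)
  (properC : proper_cone C) :
  ~ classical C <-> kite_square_sandwiching C.
Proof.
split; last exact: kite_not_classical.
move=> ncl; have [convC _ capC _] := properC.
have C0 : C 0.
  have : [set 0 : V] 0 by [].
  by rewrite -capC => -[].
case: (cone_dichotomy (proper_solid properC)) => [/(simplicial_classical properC)//|].
exact: sandwich_kite.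
Qed.
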